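(* Let $B$ be a commutative bialgebra over a field $\Bbbk$. Then $B\oslash B\cong\mathrm{HP}_c(B)=\mathrm{H}(B)$, i.e. the free commutative Hopf algebra $\mathrm{HP}_c(B)$ generated by $B$ is also the Hopf envelope $\mathrm{H}(B)$ of $B$ (with the same structure map $\eta_B$), and the map $\widehat{\eta_B}\colon B\oslash B\to\mathrm{H}(B)$, $a\oslash b\mapsto\eta_B(a)\,S(\eta_B(b))$, where $S$ is the antipode of $\mathrm{H}(B)$, is an isomorphism (of bialgebras).
   Context: For a bialgebra $B$ over a field $\Bbbk$ with counit $\varepsilon$, put $B^+=\ker(\varepsilon)$ and $B\oslash B:=(B\otimes B)/\big((B\otimes B)\Delta(B^+)\big)$, with $x\oslash y$ the class of $x\otimes y$. When $B$ is commutative, $B\oslash B$ is a quotient bialgebra of $B\otimes B^{\mathrm{cop}}$, so $(a\oslash b)(a'\oslash b')=aa'\oslash bb'$ and $\Delta(x\oslash y)=(x_1\oslash y_2)\otimes(x_2\oslash y_1)$, $\varepsilon(x\oslash y)=\varepsilon(x)\varepsilon(y)$. The Hopf envelope $\mathrm{H}(B)$ is a Hopf algebra with a bialgebra map $\eta_B\colon B\to\mathrm{H}(B)$ such that every bialgebra map from $B$ to a Hopf algebra $H$ factors through $\eta_B$ via a unique Hopf algebra map $\mathrm{H}(B)\to H$. For commutative $B$, the free commutative Hopf algebra $\mathrm{HP}_c(B)$ generated by $B$ is a commutative Hopf algebra with a bialgebra map from $B$ having the same universal property with respect to bialgebra maps from $B$ to commutative Hopf algebras. *)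

(* Defs.v *)
From HB Require Import structures.
From mathcomp Require Import all_boot all_algebra.
From mathcomp Require Import finmap boolp monalg.

Set Implicit Arguments.
Unset Strict Implicit.
Unset Printing Implicit Defensive.

Import GRing.Theory.
Local Open Scope ring_scope.
Local Open Scope quotient_scope.

Reserved Notation "x \ox y" (at level 40, left associativity).
Reserved Notation "x \oslash y" (at level 40, left associativity).
Reserved Notation "{ 'bialgebra' A -> B }"
  (at level 0, A at level 98, B at level 99).
Reserved Notation "{ 'hopf' A -> B }"
  (at level 0, A at level 98, B at level 99).

Inductive lspan (k : fieldType) (V : lmodType k) (P : V -> Prop) : V -> Prop :=
| span0 : lspan P 0
| span_cons a u v : P u -> lspan P v -> lspan P (a *: u + v).

Section Span.
Variables (k : fieldType) (V : lmodType k) (P : V -> Prop).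

Lemma span_gen u : P u -> lspan P u.
Proof. by move=> Pu; rewrite -[u]addr0 -[u]scale1r; apply: span_cons (span0 P). Qed.

Lemma spanD u v : lspan P u -> lspan P v -> lspan P (u + v).
Proof.
by elim=> [|a x y Px _ IH] Sv; rewrite ?add0r // -addrA; apply/span_cons/IH.
Qed.

Lemma spanZ a u : lspan P u -> lspan P (a *: u).
Proof.
elim=> [|b x y Px _ IH]; first by rewrite scaler0; apply: span0.
by rewrite scalerDr scalerA; apply: span_cons.
Qed.

Definition span_pred : {pred V} := fun x => `[< lspan P x >].

Lemma span_predE x : (x \in span_pred) = `[< lspan P x >]. Proof. by []. Qed.

Lemma span_zmod_closed : zmod_closed span_pred.
Proof.
split=> [|x y]; rewrite !span_predE; first exact/asboolP/span0.
move=> /asboolP Sx /asboolP Sy; apply/asboolP/spanD => //.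
by rewrite -scaleN1r; apply: spanZ.
Qed.

HB.instance Definition _ := GRing.isZmodClosed.Build V span_pred span_zmod_closed.

Definition lquot : Type := Quotient.quot span_pred.
HB.instance Definition _ := GRing.Zmodule.on lquot.

Definition lpi (v : V) : lquot := \pi_(Quotient.quot span_pred) v.
Definition lrepr (x : lquot) : V := repr (x : Quotient.quot span_pred).

Lemma lreprK : cancel lrepr lpi. Proof. exact: reprK. Qed.

Lemma lpiP u v : lpi u = lpi v <-> lspan P (u - v).
Proof.
rewrite /lpi; split=> [/eqP | S]; first by rewrite -Quotient.idealrBE => /asboolP.
by apply/eqP; rewrite -Quotient.idealrBE; apply/asboolP.
Qed.

Lemma lpiD u v : lpi (u + v) = lpi u + lpi v.
Proof. exact: (Quotient.pi_add span_pred u v). Qed.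

Definition lquot_scale (a : k) (x : lquot) : lquot := lpi (a *: lrepr x).

Lemma lpi_scale a v : lquot_scale a (lpi v) = lpi (a *: v).
Proof. by apply/lpiP; rewrite -scalerBr; apply/spanZ/lpiP/lreprK. Qed.

Fact lquot_scaleA a b x : lquot_scale a (lquot_scale b x) = lquot_scale (a * b) x.
Proof. by rewrite -(lreprK x) !lpi_scale scalerA. Qed.
Fact lquot_scale1 : left_id 1 lquot_scale.
Proof. by move=> x; rewrite -(lreprK x) lpi_scale scale1r. Qed.
Fact lquot_scaleDr : right_distributive lquot_scale +%R.
Proof.
by move=> a x y; rewrite -(lreprK x) -(lreprK y) -lpiD !lpi_scale -lpiD scalerDr.
Qed.
Fact lquot_scaleDl x : {morph lquot_scale^~ x : a b / a + b}.
Proof. by move=> a b; rewrite -(lreprK x) !lpi_scale -lpiD scalerDl. Qed.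

HB.instance Definition _ := GRing.Zmodule_isLmodule.Build k lquot
  lquot_scaleA lquot_scale1 lquot_scaleDr lquot_scaleDl.

Lemma lpi_linear : linear lpi.
Proof. by move=> a u v; rewrite lpiD -lpi_scale. Qed.
HB.instance Definition _ := GRing.isLinear.Build k V lquot *:%R lpi lpi_linear.

Lemma lpi_eq0 v : lpi v = 0 <-> lspan P v.
Proof. by rewrite -(linear0 lpi) lpiP subr0. Qed.

(* Only meaningful when f is linear and vanishes on P. *)
Definition lquot_lift (U : Type) (f : V -> U) (x : lquot) : U := f (lrepr x).

Lemma span_ker (U : lmodType k) (f : V -> U) :
  linear f -> (forall u, P u -> f u = 0) -> forall v, lspan P v -> f v = 0.
Proof.
move=> fl fP v; pose F : {linear V -> U} :=
  HB.pack f (GRing.isLinear.Build k V U *:%R f fl).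
elim=> [|a x y Px _ IH]; first exact: (linear0 F).
by rewrite fl fP // IH scaler0 addr0.
Qed.

Lemma lquot_liftE (U : lmodType k) (f : V -> U) :
  linear f -> (forall u, P u -> f u = 0) ->
  forall v, lquot_lift f (lpi v) = f v.
Proof.
move=> fl fP v; pose F : {linear V -> U} :=
  HB.pack f (GRing.isLinear.Build k V U *:%R f fl).
apply/eqP; rewrite -subr_eq0; apply/eqP; rewrite /lquot_lift -(linearB F).
by apply: (span_ker fl fP); apply/lpiP/lreprK.
Qed.

Lemma lquot_lift_linear (U : lmodType k) (f : V -> U) :
  linear f -> (forall u, P u -> f u = 0) -> linear (lquot_lift f).
Proof.
move=> fl fP a x y; rewrite -(lreprK x) -(lreprK y) -lpi_linear.
by rewrite !lquot_liftE // fl.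
Qed.

End Span.

Section Tensor.
Variables (k : fieldType) (V W : lmodType k).

Notation freeVW := {malg k[(V * W)%type]}.

Inductive tensor_rel : freeVW -> Prop :=
| tensor_rel_left a x x' y :
    tensor_rel (<< (a *: x + x', y) >> - a *: << (x, y) >> - << (x', y) >>)
| tensor_rel_right a x y y' :
    tensor_rel (<< (x, a *: y + y') >> - a *: << (x, y) >> - << (x, y') >>).

Definition tensor : Type := lquot tensor_rel.
HB.instance Definition _ := GRing.Lmodule.on tensor.

Definition tens (x : V) (y : W) : tensor := lpi tensor_rel << (x, y) >>.
Local Notation "x \ox y" := (tens x y) : ring_scope.

Lemma tens_bilinear : bilinear_for *:%R *:%R tens.
Proof.
split=> [y a x x' | x a y y'].
  rewrite -lpi_linear; apply/lpiP/span_gen.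
  by rewrite opprD addrA; apply: tensor_rel_left.
rewrite -lpi_linear; apply/lpiP/span_gen.
by rewrite opprD addrA; apply: tensor_rel_right.
Qed.

Lemma tens0l y : 0 \ox y = 0.
Proof.
by have := tens_bilinear.1 y (-1) 0 0; rewrite /= scaler0 addr0 scaleN1r addNr.
Qed.

Definition flift (U : lmodType k) (f : V -> W -> U) (g : freeVW) : U :=
  \sum_(p <- msupp g) g@_p *: f p.1 p.2.

Lemma flift_w (U : lmodType k) (f : V -> W -> U) (g : freeVW)
    (d : {fset (V * W)%type}) :
  fsubset (msupp g) d ->
  flift f g = \sum_(p <- d) g@_p *: f p.1 p.2.
Proof.
move=> le; rewrite /flift; apply: (big_fset_incl _ le) => p _ /mcoeff_outdom ->.
by rewrite scale0r.
Qed.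

Lemma flift_linear (U : lmodType k) (f : V -> W -> U) : linear (flift f).
Proof.
move=> a g h; pose d := fsetU (msupp g) (msupp h).
have sg : fsubset (msupp g) d by apply: fsubsetUl.
have sh : fsubset (msupp h) d by apply: fsubsetUr.
have sgh : fsubset (msupp (a *: g + h)) d.
  apply: fsubset_trans (msuppD_le _ _) _.
  by apply: fsetSU; apply: msuppZ_le.
rewrite (flift_w f sg) (flift_w f sh) (flift_w f sgh) scaler_sumr -big_split /=.
by apply: eq_bigr => p _; rewrite mcoeffD mcoeffZ scalerDl scalerA.
Qed.

HB.instance Definition _ (U : lmodType k) (f : V -> W -> U) :=
  GRing.isLinear.Build k freeVW U *:%R (flift f) (@flift_linear U f).

Lemma fliftU (U : lmodType k) (f : V -> W -> U) p : flift f << p >> = f p.1 p.2.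
Proof.
rewrite (@flift_w _ f _ (fset1 p)) ?msuppU_le //.
by rewrite big_seq_fset1 mcoeffUU scale1r.
Qed.

(* The linear map V (x) W -> U induced by f; it is total in f, but only
   meaningful when f is bilinear, cf. tliftE. *)
Definition tlift (U : lmodType k) (f : V -> W -> U) : tensor -> U :=
  lquot_lift (flift f).

Section TLift.
Variables (U : lmodType k) (f : V -> W -> U).
Hypothesis f_bilin : bilinear_for *:%R *:%R f.

Let f_rel u : tensor_rel u -> flift f u = 0.
Proof.
case=> [a x x' y | a x y y'].
  rewrite !linearB linearZ_LR /= !fliftU /=.
  by rewrite (f_bilin.1 y) addrAC addrK subrr.
rewrite !linearB linearZ_LR /= !fliftU /=.
by rewrite (f_bilin.2 x) addrAC addrK subrr.
Qed.

Lemma tliftE x y : tlift f (x \ox y) = f x y.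
Proof. by rewrite /tlift lquot_liftE ?fliftU //; apply: flift_linear. Qed.

Lemma tlift_linear : linear (tlift f).
Proof. by apply: lquot_lift_linear => //; apply: flift_linear. Qed.

End TLift.

Lemma tensor_ind (P : tensor -> Prop) :
  (forall x y, P (x \ox y)) -> (forall s t, P s -> P t -> P (s + t)) ->
  forall t, P t.
Proof.
move=> Pt PD t; rewrite -(lreprK t) (monalgE (lrepr t)).
rewrite (linear_sum (lpi tensor_rel)); apply: big_ind => //.
  by rewrite -(tens0l 0); exact: Pt.
move=> [x y] _ /=.
suff -> : lpi tensor_rel << (lrepr t)@_(x, y) *g (x, y) >>
  = ((lrepr t)@_(x, y) *: x) \ox y by apply: Pt.
set c := _@_(x, y).
have -> : << c *g (x, y) >> = c *: << (x, y) >> :> freeVW.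
  by apply/malgP => p; rewrite mcoeffZ !mcoeffU mulrnAr mulr1.
by rewrite linearZ_LR -[c *: x]addr0 (tens_bilinear.1 y) tens0l addr0.
Qed.

End Tensor.

Notation "x \ox y" := (tens x y) : ring_scope.

(* Linearity as an opaque constant, so that the [lin] tactic below works on
   the syntax of the function; raw unification of [linear] goals is very slow. *)

Definition islin (k : fieldType) (V W : lmodType k) (f : V -> W) : Prop := linear f.

Section LinearRules.
Variables (k : fieldType) (U V W X : lmodType k).

Lemma islinP (f : V -> W) : islin f -> linear f. Proof. by []. Qed.
Lemma islinI (f : V -> W) : linear f -> islin f. Proof. by []. Qed.

Lemma islinD (f : V -> W) : islin f -> {morph f : x y / x + y}.
Proof. by move=> fl x y; have := fl 1 x y; rewrite !scale1r. Qed.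

Lemma islinZ (f : V -> W) a x : islin f -> f (a *: x) = a *: f x.
Proof.
move=> fl; have := fl (-1) 0 0; rewrite scaler0 addr0 scaleN1r addNr => f0.
by rewrite -[a *: x]addr0 fl f0 addr0.
Qed.

Lemma lin_id : islin (fun x : V => x). Proof. by []. Qed.

Lemma lin_eta (f : V -> W) : islin (fun x => f x) -> islin f. Proof. by []. Qed.

Lemma lin_lin (f : {linear V -> W}) : islin (fun x => f x).
Proof. exact: linearP. Qed.

Lemma lin_comp (g : V -> W) (f : U -> V) :
  islin g -> islin f -> islin (fun x => g (f x)).
Proof. by move=> gl fl a x y; rewrite fl gl. Qed.

Lemma lin_tensl (f : U -> V) (w : W) : islin f -> islin (fun x => f x \ox w).
Proof. by move=> fl a x y; rewrite fl; apply: (tens_bilinear V W).1. Qed.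

Lemma lin_tensr (f : U -> W) (v : V) : islin f -> islin (fun x => v \ox f x).
Proof. by move=> fl a x y; rewrite fl; apply: (tens_bilinear V W).2. Qed.

Lemma lin_scale (c : k) (f : U -> V) : islin f -> islin (fun x => c *: f x).
Proof. by move=> fl a x y; rewrite fl scalerDr !scalerA mulrC. Qed.

Lemma lin_scalel (f : U -> k) (v : V) : scalar f -> islin (fun x => f x *: v).
Proof. by move=> fl a x y; rewrite fl scalerDl scalerA. Qed.

Lemma lin_tlift (g : V -> W -> X) (f : U -> tensor V W) :
  (forall y, islin (fun x => g x y)) -> (forall x, islin (fun y => g x y)) ->
  islin f -> islin (fun x => tlift g (f x)).
Proof. by move=> g1 g2 fl a x y; rewrite fl; apply: tlift_linear. Qed.

Lemma lin_tliftF (F : U -> V -> W -> X) (t : tensor V W) :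
  (forall v w, islin (fun x => F x v w)) -> islin (fun x => tlift (F x) t).
Proof.
move=> Fl a x y; rewrite /tlift /lquot_lift /flift scaler_sumr -big_split /=.
by apply: eq_bigr => p _; rewrite Fl scalerDr !scalerA mulrC.
Qed.

Lemma tliftb (f : V -> W -> X) x y :
  (forall y, islin (fun x => f x y)) -> (forall x, islin (fun y => f x y)) ->
  tlift f (x \ox y) = f x y.
Proof. by move=> f1 f2; apply: tliftE. Qed.

Lemma eq_tlift (f g : V -> W -> X) t : f =2 g -> tlift f t = tlift g t.
Proof. by move=> fg; apply: eq_bigr => p _; rewrite fg. Qed.

Lemma tlift_comp (g : X -> U) (f : V -> W -> X) t :
  islin g -> g (tlift f t) = tlift (fun v w => g (f v w)) t.
Proof.
move=> gl; pose G : {linear X -> U} := HB.pack g (GRing.isLinear.Build k X U *:%R g gl).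
rewrite -[g]/(G : _ -> _) /tlift /lquot_lift /flift linear_sum.
by apply: eq_bigr => p _; rewrite linearZ_LR.
Qed.

Lemma tensor_ext (f g : tensor V W -> X) :
  islin f -> islin g -> (forall v w, f (v \ox w) = g (v \ox w)) -> f =1 g.
Proof.
move=> fl gl fg; apply: tensor_ind => // s t Es Et.
by rewrite -[s]scale1r fl gl Es Et.
Qed.

End LinearRules.

Lemma exch_tlift (k : fieldType) (V W V' W' X : lmodType k)
    (F : V -> W -> V' -> W' -> X) s t :
  tlift (fun a b => tlift (F a b) t) s =
  tlift (fun c d => tlift (fun a b => F a b c d) s) t.
Proof.
rewrite /tlift /lquot_lift /flift.
under eq_bigr do rewrite scaler_sumr.
under [in RHS]eq_bigr do rewrite scaler_sumr.
rewrite exchange_big /=; apply: eq_bigr => p _; apply: eq_bigr => q _.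
by rewrite !scalerA mulrC.
Qed.

Section LinearRulesAlg.
Variables (k : fieldType) (U : lmodType k) (A : algType k).

Lemma lin_mull (f : U -> A) (c : A) : islin f -> islin (fun x => f x * c).
Proof. by move=> fl a x y; rewrite fl mulrDl scalerAl. Qed.

Lemma lin_mulr (f : U -> A) (c : A) : islin f -> islin (fun x => c * f x).
Proof. by move=> fl a x y; rewrite fl mulrDr scalerAr. Qed.
End LinearRulesAlg.

Opaque tens tlift islin.

Ltac lin_base := fail.
Ltac lin_mull_tac f := refine (@lin_mull _ _ _ f _ _).
Ltac lin_mulr_tac g := refine (@lin_mulr _ _ _ g _ _).
Ltac is_const f := lazymatch f with (fun _ => ?t) => let u := constr:(t) in idtac end.
Ltac lin_step :=
  lazymatch goal with
  | |- forall _, _ => move=> ?; cbv beta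
  | |- islin (fun x => x) => exact: lin_id
  | H : islin ?f |- islin ?f => exact: H
  | |- islin (fun x => tens (@?f x) (@?g x)) =>
      tryif is_const g then refine (@lin_tensl _ _ _ _ f _ _)
      else refine (@lin_tensr _ _ _ _ g _ _)
  | |- islin (fun x => @?f x * @?g x) =>
      tryif is_const g then lin_mull_tac f else lin_mulr_tac g
  | |- @islin ?k ?U ?V (fun x => @?c x *: @?f x) =>
      tryif is_const c then refine (@lin_scale k U V _ f _) else lin_base
  | |- islin (fun x => tlift (@?g x) (@?f x)) =>
      tryif is_const f then refine (@lin_tliftF _ _ _ _ _ g _ _)
      else refine (@lin_tlift _ _ _ _ _ _ f _ _ _)
  | |- islin (fun _ => _) => lin_base
  | |- islin ?f => refine (@lin_eta _ _ _ f _)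
  end.
Ltac lin := repeat (lin_step; cbv beta).

Lemma tlift_tens (k : fieldType) (V W : lmodType k) (t : tensor V W) :
  tlift (fun v w => v \ox w) t = t.
Proof.
move: t; apply: tensor_ext => [||v w]; [by lin | by lin |].
by rewrite tliftb; lin.
Qed.

Definition tmap (k : fieldType) (V W V' W' : lmodType k)
    (f : V -> V') (g : W -> W') : tensor V W -> tensor V' W' :=
  tlift (fun x y => f x \ox g y).

Definition tassoc (k : fieldType) (U V W : lmodType k) :
    tensor (tensor U V) W -> tensor U (tensor V W) :=
  tlift (fun s w => tlift (fun u v => u \ox (v \ox w)) s).

Section TensorAlgebra.
Variables (k : fieldType) (A C : algType k).
Local Notation T := (tensor A C).

Definition tens_mul (s t : T) : T :=
  tlift (fun a c => tlift (fun a' c' => (a * a') \ox (c * c')) t) s.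

Lemma tens_mulE a c a' c' :
  tens_mul (a \ox c) (a' \ox c') = (a * a') \ox (c * c').
Proof. by rewrite /tens_mul !tliftb; lin. Qed.

Lemma tens_mul_linl t : islin (fun s => tens_mul s t).
Proof. by rewrite /tens_mul; lin. Qed.

Lemma tens_mul_linr s : islin (fun t => tens_mul s t).
Proof. by rewrite /tens_mul; lin. Qed.

End TensorAlgebra.

Section TensorRing.
Variables (k : fieldType) (A C : algType k).
Local Notation T := (tensor A C).
Local Notation tens_one := (1 \ox 1 : T).

Ltac lin_base ::=
  lazymatch goal with
  | |- islin (fun x => tens_mul (@?f x) (@?g x)) =>
      tryif is_const g then refine (lin_comp (tens_mul_linl _) (f := f) _)
      else refine (lin_comp (tens_mul_linr _) (f := g) _)
  end.

Lemma tens_mulA : associative (@tens_mul k A C).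
Proof.
move=> r s t; move: r; apply: tensor_ext; [by lin | by lin | move=> a c].
move: s; apply: tensor_ext; [by lin | by lin | move=> a' c'].
move: t; apply: tensor_ext; [by lin | by lin | move=> a'' c''].
by rewrite !tens_mulE !mulrA.
Qed.

Lemma tens_mul1 : left_id tens_one (@tens_mul k A C).
Proof.
by apply: tensor_ext; [by lin | by lin | move=> a c]; rewrite tens_mulE !mul1r.
Qed.

Lemma tens_mulr1 : right_id tens_one (@tens_mul k A C).
Proof.
by apply: tensor_ext; [by lin | by lin | move=> a c]; rewrite tens_mulE !mulr1.
Qed.

Lemma tens_mulDl : left_distributive (@tens_mul k A C) +%R.
Proof. by move=> r s t; rewrite (islinD (tens_mul_linl t)). Qed.

Lemma tens_mulDr : right_distributive (@tens_mul k A C) +%R.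
Proof. by move=> r s t; rewrite (islinD (tens_mul_linr r)). Qed.

HB.instance Definition _ := GRing.Zmodule_isPzRing.Build T
  tens_mulA tens_mul1 tens_mulr1 tens_mulDl tens_mulDr.

Lemma tensM a c a' c' : (a \ox c) * (a' \ox c') = (a * a') \ox (c * c') :> T.
Proof. exact: tens_mulE. Qed.
Lemma tens1 : 1 = 1 \ox 1 :> T. Proof. by []. Qed.

Lemma lin_tmull (U : lmodType k) (f : U -> T) (c : T) :
  islin f -> islin (fun x => f x * c).
Proof. exact: (lin_comp (tens_mul_linl c)). Qed.
Lemma lin_tmulr (U : lmodType k) (f : U -> T) (c : T) :
  islin f -> islin (fun x => c * f x).
Proof. exact: (lin_comp (tens_mul_linr c)). Qed.
End TensorRing.

Ltac lin_mull_tac f ::=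
  first [refine (@lin_mull _ _ _ f _ _) | refine (@lin_tmull _ _ _ _ f _ _)].
Ltac lin_mulr_tac g ::=
  first [refine (@lin_mulr _ _ _ g _ _) | refine (@lin_tmulr _ _ _ _ g _ _)].

Lemma tensMC (k : fieldType) (A C : comAlgType k) :
  commutative (@GRing.mul (tensor A C)).
Proof.
move=> s t; move: s; apply: tensor_ext; [by lin | by lin | move=> a c].
move: t; apply: tensor_ext; [by lin | by lin | move=> a' c'].
by rewrite !tensM [a * _]mulrC [c * _]mulrC.
Qed.

HB.instance Definition _ (k : fieldType) (A C : comAlgType k) :=
  GRing.PzRing_hasCommutativeMul.Build (tensor A C) (@tensMC k A C).

HB.mixin Record Algebra_isBialgebra (k : fieldType) B of GRing.Algebra k B := {
  comul : B -> tensor B B;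
  counit : B -> k;
  comul_linear : linear comul;
  comul_monoid_morphism : monoid_morphism comul;
  counit_linear : scalar counit;
  counit_monoid_morphism : monoid_morphism counit;
  comulA_subproof : forall b, tassoc (tmap comul id (comul b)) = tmap id comul (comul b);
  comul_counitl_subproof : forall b, tlift (fun x y => counit x *: y) (comul b) = b;
  comul_counitr_subproof : forall b, tlift (fun x y => counit y *: x) (comul b) = b
}.

#[short(type="bialgType")]
HB.structure Definition Bialgebra (k : fieldType) :=
  {B of GRing.Algebra k B & Algebra_isBialgebra k B}.

#[short(type="comBialgType")]
HB.structure Definition ComBialgebra (k : fieldType) :=
  {B of GRing.ComNzRing B & Bialgebra k B}.

HB.mixin Record Bialgebra_isHopf (k : fieldType) H of Bialgebra k H := {
  antipode : H -> H;
  antipode_linear : linear antipode;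
  antipodel_subproof : forall h : H,
    tlift (fun x y => antipode x * y) (comul h) = (counit h)%:A;
  antipoder_subproof : forall h : H,
    tlift (fun x y => x * antipode y) (comul h) = (counit h)%:A
}.

#[short(type="hopfType")]
HB.structure Definition Hopf (k : fieldType) :=
  {H of Bialgebra k H & Bialgebra_isHopf k H}.

HB.instance Definition _ (k : fieldType) (B : bialgType k) :=
  GRing.isLinear.Build k B (tensor B B) *:%R (@comul k B) comul_linear.
HB.instance Definition _ (k : fieldType) (B : bialgType k) :=
  GRing.isMonoidMorphism.Build B (tensor B B) (@comul k B) comul_monoid_morphism.
HB.instance Definition _ (k : fieldType) (B : bialgType k) :=
  GRing.isLinear.Build k B k *%R (@counit k B) counit_linear.
HB.instance Definition _ (k : fieldType) (B : bialgType k) :=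
  GRing.isMonoidMorphism.Build B k (@counit k B) counit_monoid_morphism.
HB.instance Definition _ (k : fieldType) (H : hopfType k) :=
  GRing.isLinear.Build k H H *:%R (@antipode k H) antipode_linear.

(* Restatements with the canonical structures of B rather than the mixin's. *)
Section BialgebraAxioms.
Variables (k : fieldType) (B : bialgType k) (H : hopfType k).

Lemma comulA (b : B) : tassoc (tmap comul id (comul b)) = tmap id comul (comul b).
Proof. exact: comulA_subproof. Qed.

Lemma comul_counitl (b : B) : tlift (fun x y => counit x *: y) (comul b) = b.
Proof. exact: comul_counitl_subproof. Qed.

Lemma comul_counitr (b : B) : tlift (fun x y => counit y *: x) (comul b) = b.
Proof. exact: comul_counitr_subproof. Qed.

Lemma antipodel (h : H) :
  tlift (fun x y => antipode x * y) (comul h) = (counit h)%:A.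
Proof. exact: antipodel_subproof. Qed.

Lemma antipoder (h : H) :
  tlift (fun x y => x * antipode y) (comul h) = (counit h)%:A.
Proof. exact: antipoder_subproof. Qed.

End BialgebraAxioms.

HB.mixin Record isCoalgMorphism (k : fieldType) (B C : bialgType k) (f : B -> C) := {
  comul_morph : forall b, comul (f b) = tmap f f (comul b);
  counit_morph : forall b, counit (f b) = counit b
}.

HB.structure Definition BialgMorphism (k : fieldType) (B C : bialgType k) :=
  {f of isCoalgMorphism k B C f & @GRing.LRMorphism k B C *:%R f}.
Notation "{ 'bialgebra' A -> B }" := (BialgMorphism.type A B) : type_scope.

(* Automatic for a bialgebra map, but part of the definition of Hopf map here. *)
HB.mixin Record isAntipodeMorphism (k : fieldType) (H K : hopfType k) (f : H -> K) := {
  antipode_morph : forall h, f (antipode h) = antipode (f h)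
}.

HB.structure Definition HopfMorphism (k : fieldType) (H K : hopfType k) :=
  {f of @BialgMorphism k H K f & isAntipodeMorphism k H K f}.
Notation "{ 'hopf' A -> B }" := (HopfMorphism.type A B) : type_scope.

Section Envelope.
Variables (k : fieldType) (B : bialgType k) (H : hopfType k).
Variable eta : {bialgebra B -> H}.

Definition is_hopf_envelope : Prop :=
  forall (K : hopfType k) (f : {bialgebra B -> K}),
    exists g : {hopf H -> K}, g \o eta =1 f /\
      forall g' : {hopf H -> K}, g' \o eta =1 f -> g' =1 g.

Definition is_free_comm_hopf : Prop :=
  commutative (@GRing.mul H) /\
  forall (K : hopfType k) (f : {bialgebra B -> K}), commutative (@GRing.mul K) ->
    exists g : {hopf H -> K}, g \o eta =1 f /\
      forall g' : {hopf H -> K}, g' \o eta =1 f -> g' =1 g.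

End Envelope.

Section BialgebraTheory.
Variables (k : fieldType) (B : bialgType k).

Lemma lin_comul (U : lmodType k) (f : U -> B) :
  islin f -> islin (fun x => comul (f x)).
Proof. by apply: lin_comp; apply: islinI; apply: linearP. Qed.

Lemma lin_counit_scale (U W : lmodType k) (f : U -> B) (w : W) :
  islin f -> islin (fun x => counit (f x) *: w).
Proof.
move=> /islinP fl; apply: lin_scalel => a x y.
by rewrite fl linearP.
Qed.

(* In Sweedler notation: F b11 b12 b2 = F b1 b21 b22, counit b1 *: F b2 = F b. *)
Lemma coassoc_sum (X : lmodType k) (F : B -> B -> B -> X) b :
  (forall y z, islin (fun x => F x y z)) ->
  (forall x z, islin (fun y => F x y z)) ->
  (forall x y, islin (fun z => F x y z)) ->
  tlift (fun s z => tlift (fun x y => F x y z) (comul s)) (comul b) =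
  tlift (fun x s => tlift (fun y z => F x y z) (comul s)) (comul b).
Proof.
move=> F1 F2 F3; pose G := tlift (fun x t => tlift (F x) t).
have Gl : islin G by rewrite /G; lin; [exact: F1 | exact: F2 | exact: F3].
have GE x t : G (x \ox t) = tlift (F x) t.
  by rewrite /G tliftb //; lin; [exact: F1 | exact: F2 | exact: F3].
transitivity (G (tmap id comul (comul b))); last first.
  by rewrite /tmap (tlift_comp _ _ Gl); apply: eq_tlift => x s; apply: GE.
have al : islin (@tassoc k B B B) by rewrite /tassoc; lin.
rewrite -comulA {1}/tmap (tlift_comp _ _ al) (tlift_comp _ _ Gl).
apply: eq_tlift => s z; rewrite /tassoc tliftb; [| by lin | by lin].
rewrite (tlift_comp _ _ Gl); apply: eq_tlift => x y.
by rewrite GE tliftb; [| exact: F2 | exact: F3].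
Qed.

Lemma counitl_sum (X : lmodType k) (F : B -> X) b :
  islin F -> tlift (fun x y => counit x *: F y) (comul b) = F b.
Proof.
move=> Fl; rewrite -[in RHS](comul_counitl b) (tlift_comp _ _ Fl).
apply: eq_tlift => x y.
exact: esym (islinZ _ _ Fl).
Qed.

Lemma counitr_sum (X : lmodType k) (F : B -> X) b :
  islin F -> tlift (fun x y => counit y *: F x) (comul b) = F b.
Proof.
move=> Fl; rewrite -[in RHS](comul_counitr b) (tlift_comp _ _ Fl).
apply: eq_tlift => x y.
exact: esym (islinZ _ _ Fl).
Qed.

Lemma lin_counit (U : lmodType k) (f : U -> B) :
  islin f -> islin (fun x => counit (f x) : k^o).
Proof. by move=> /islinP fl a x y; rewrite fl linearP. Qed.

End BialgebraTheory.

Section Oslash.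
Variables (k : fieldType) (B : bialgType k).

(* The products s * comul b with counit b = 0 span the left ideal
   (B (x) B) Delta(ker counit). *)
Definition oslash_rel (t : tensor B B) : Prop :=
  exists (s : tensor B B) (b : B), counit b = 0 /\ t = s * comul b.

Definition Oslash : Type := lquot oslash_rel.
HB.instance Definition _ := GRing.Lmodule.on Oslash.

Definition oslash_pi : tensor B B -> Oslash := lpi oslash_rel.
Definition oslash (x y : B) : Oslash := oslash_pi (x \ox y).

Lemma lin_oslash_pi (U : lmodType k) (f : U -> tensor B B) :
  islin f -> islin (fun x => oslash_pi (f x)).
Proof. by apply: lin_comp; apply: islinI; apply: lpi_linear. Qed.

Lemma oslash_piP t : exists s, t = oslash_pi s.
Proof. by exists (lrepr t); rewrite /oslash_pi lreprK. Qed.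

End Oslash.
Notation "x \oslash y" := (oslash x y) : ring_scope.
Arguments oslash_pi {k B}.

Ltac lin_base ::=
  lazymatch goal with
  | |- islin (fun x => comul (@?f x)) => refine (@lin_comul _ _ _ f _)
  | |- islin (fun x => counit (@?f x) *: _) => refine (@lin_counit_scale _ _ _ _ f _ _)
  | |- islin (fun x => counit (@?f x)) => refine (@lin_counit _ _ _ f _)
  | |- islin (fun x => oslash_pi (@?f x)) => refine (@lin_oslash_pi _ _ _ f _)
  | |- islin (fun x => oslash (@?f x) (@?g x)) => rewrite /oslash
  end.
Opaque oslash_pi.

Section OslashRing.
Variables (k : fieldType) (B : comBialgType k).
Local Notation Q := (Oslash B).

Lemma span_oslashM (s t : tensor B B) :
  lspan (oslash_rel (B := B)) t -> lspan (oslash_rel (B := B)) (s * t).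
Proof.
have sl : islin (fun t : tensor B B => s * t) by lin.
elim=> [|a x y [u [b [b0 ->]]] _ IH].
  by rewrite mulr0; apply: span0.
have /islinP -> := sl.
by rewrite mulrA; apply: span_cons => //; exists (s * u), b.
Qed.

Lemma oslash_piE (s t : tensor B B) :
  oslash_pi s = oslash_pi t <-> lspan (oslash_rel (B := B)) (s - t).
Proof. exact: lpiP. Qed.

Definition oslash_mul (x y : Q) : Q := oslash_pi (lrepr x * lrepr y).

Lemma oslash_mul_pi s t : oslash_mul (oslash_pi s) (oslash_pi t) = oslash_pi (s * t).
Proof.
have r u : lspan (oslash_rel (B := B)) (lrepr (oslash_pi u) - u).
  by apply/oslash_piE; rewrite -[RHS]lreprK.
apply/oslash_piE; set s' := lrepr _; set t' := lrepr _.
have -> : s' * t' - s * t = t' * (s' - s) + s * (t' - t).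
  by rewrite !mulrBr [t' * s']mulrC [t' * s]mulrC addrA subrK.
by apply: spanD; apply: span_oslashM; apply: r.
Qed.

Definition oslash_one : Q := oslash_pi 1.

Fact oslash_mulA : associative oslash_mul.
Proof.
move=> x y z; have [s ->] := oslash_piP x; have [t ->] := oslash_piP y.
by have [u ->] := oslash_piP z; rewrite !oslash_mul_pi mulrA.
Qed.

Fact oslash_mulC : commutative oslash_mul.
Proof.
move=> x y; have [s ->] := oslash_piP x; have [t ->] := oslash_piP y.
by rewrite !oslash_mul_pi mulrC.
Qed.

Fact oslash_mul1 : left_id oslash_one oslash_mul.
Proof. by move=> x; have [s ->] := oslash_piP x; rewrite oslash_mul_pi mul1r. Qed.

Fact oslash_mulDl : left_distributive oslash_mul +%R.
Proof.
have piD := islinD (lin_oslash_pi (@lin_id _ (tensor B B))).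
move=> x y z; have [s ->] := oslash_piP x; have [t ->] := oslash_piP y.
by have [u ->] := oslash_piP z; rewrite -piD !oslash_mul_pi mulrDl piD.
Qed.

Lemma oslash_pi_lin : islin (@oslash_pi k B).
Proof. by lin. Qed.

Definition tens_counit : tensor B B -> k^o :=
  tlift (fun x y : B => counit x *: (counit y : k^o)).

Lemma tens_counit_lin : islin tens_counit.
Proof. by rewrite /tens_counit; lin. Qed.

Lemma tens_counitE x y : tens_counit (x \ox y) = counit x * counit y.
Proof. by rewrite /tens_counit tliftb; lin. Qed.

Lemma tens_counitM s t : tens_counit (s * t) = tens_counit s * tens_counit t.
Proof.
have cl := tens_counit_lin.
move: s; apply: tensor_ext => [||a c].
- by apply: lin_comp cl _; lin.
- by apply: lin_mull.
move: t; apply: tensor_ext => [||a' c'].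
- by apply: lin_comp cl _; lin.
- by apply: lin_mulr.
by rewrite tensM !tens_counitE !rmorphM mulrACA.
Qed.

Lemma tens_counit_comul b : tens_counit (comul b) = counit b.
Proof. by exact: (counitl_sum (F := fun y : B => counit y : k^o) b (lin_counit (@lin_id _ B))). Qed.

Fact tens_counit_rel t : oslash_rel (B := B) t -> tens_counit t = 0.
Proof.
by move=> [s [b [b0 ->]]]; rewrite tens_counitM tens_counit_comul b0 mulr0.
Qed.

Definition oslash_counit (x : Q) : k := tens_counit (lrepr x).

Lemma oslash_counit_pi s : oslash_counit (oslash_pi s) = tens_counit s.
Proof. exact: (lquot_liftE (islinP tens_counit_lin) tens_counit_rel). Qed.

Fact oslash_one_neq0 : oslash_one != 0.
Proof.
apply/eqP => /(congr1 oslash_counit).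
rewrite -(scale0r (oslash_pi 0)) -(islinZ _ _ oslash_pi_lin) scale0r.
rewrite !oslash_counit_pi tens1 tens_counitE !rmorph1 mulr1.
rewrite -(scale0r 0) (islinZ _ _ tens_counit_lin) scale0r.
by move/eqP; rewrite oner_eq0.
Qed.

HB.instance Definition _ := GRing.Zmodule_isComNzRing.Build Q
  oslash_mulA oslash_mulC oslash_mul1 oslash_mulDl oslash_one_neq0.

Lemma oslash_piM s t : oslash_pi (s * t) = oslash_pi s * oslash_pi t :> Q.
Proof. by rewrite -oslash_mul_pi. Qed.

Lemma oslash_pi1 : oslash_pi 1 = 1 :> Q.
Proof. by []. Qed.

Fact oslash_scalerAl (a : k) (x y : Q) : a *: (x * y) = (a *: x) * y.
Proof.
have [s ->] := oslash_piP x; have [t ->] := oslash_piP y.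
rewrite -oslash_piM -!(islinZ _ _ oslash_pi_lin) -oslash_piM.
by congr oslash_pi; apply/esym/(islinZ a s (tens_mul_linl t)).
Qed.

HB.instance Definition _ := GRing.Lmodule_isLalgebra.Build k Q oslash_scalerAl.
HB.instance Definition _ := GRing.Lalgebra_isComAlgebra.Build k Q.

Lemma oslashM (x y x' y' : B) :
  (x \oslash y) * (x' \oslash y') = (x * x') \oslash (y * y') :> Q.
Proof. by rewrite /oslash -tensM oslash_piM. Qed.

End OslashRing.

Section OslashBialgebra.
Variables (k : fieldType) (B : comBialgType k).
Local Notation Q := (Oslash B).

Lemma oslash_pi_islin : islin (fun t : tensor B B => oslash_pi t : Q).
Proof. by lin. Qed.

(* Delta (x (/) y) = (x1 (/) y2) (x) (x2 (/) y1) *)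
Definition oslash_mix (s t : tensor B B) : tensor Q Q :=
  tlift (fun x1 x2 => tlift (fun y1 y2 =>
    (x1 \oslash y2) \ox (x2 \oslash y1)) t) s.

Lemma oslash_mix_linl t : islin (fun s => oslash_mix s t).
Proof. by rewrite /oslash_mix; lin. Qed.
Lemma oslash_mix_linr s : islin (fun t => oslash_mix s t).
Proof. by rewrite /oslash_mix; lin. Qed.
Lemma oslash_mixE x1 x2 y1 y2 :
  oslash_mix (x1 \ox x2) (y1 \ox y2) = (x1 \oslash y2) \ox (x2 \oslash y1).
Proof. by rewrite /oslash_mix !tliftb; lin. Qed.

Definition tens_comul : tensor B B -> tensor Q Q :=
  tlift (fun x y => oslash_mix (comul x) (comul y)).

Ltac lin_mix :=
  lazymatch goal with
  | |- islin (fun x => oslash_mix (@?f x) (@?g x)) =>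
      tryif is_const g then refine (lin_comp (oslash_mix_linl _) (f := f) _)
      else refine (lin_comp (oslash_mix_linr _) (f := g) _)
  end.
Ltac linm := repeat (first [lin_mix | lin_step]; cbv beta).

Lemma oslash_mixM s s' t t' :
  oslash_mix (s * s') (t * t') = oslash_mix s t * oslash_mix s' t'.
Proof.
move: s; apply: tensor_ext; [by linm | by linm | move=> a1 a2].
move: s'; apply: tensor_ext; [by linm | by linm | move=> b1 b2].
move: t; apply: tensor_ext; [by linm | by linm | move=> c1 c2].
move: t'; apply: tensor_ext; [by linm | by linm | move=> d1 d2].
by rewrite 2!(@tensM k B B) 3!oslash_mixE (@tensM k Q Q) 2!oslashM.
Qed.

Lemma tens_comul_lin : islin tens_comul.
Proof. by rewrite /tens_comul; linm. Qed.

Lemma tens_comulE x y : tens_comul (x \ox y) = oslash_mix (comul x) (comul y).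
Proof. by rewrite /tens_comul tliftb //; linm. Qed.

Lemma tens_comulM s t : tens_comul (s * t) = tens_comul s * tens_comul t.
Proof.
have cl := tens_comul_lin.
move: s; apply: tensor_ext => [||a c].
- by apply: lin_comp cl _; lin.
- by apply: lin_tmull.
move: t; apply: tensor_ext => [||a' c'].
- by apply: lin_comp cl _; lin.
- by apply: lin_tmulr.
by rewrite (@tensM k B B) !tens_comulE 2!(rmorphM (@comul k B)) oslash_mixM.
Qed.

Lemma oslash_pi_comul b : oslash_pi (comul b) = counit b *: 1 :> Q.
Proof.
rewrite -oslash_pi1 -(islinZ _ _ oslash_pi_islin).
have c1 : comul (1 : B) = 1 by case: (@comul_monoid_morphism k B).
have e1 : counit (1 : B) = 1 by case: (@counit_monoid_morphism k B).
have /islinP cl := lin_comul (@lin_id _ B).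
have el := @counit_linear k B.
apply/oslash_piE/span_gen; exists 1, (- counit b *: 1 + b); split.
  by rewrite el e1 mulr1 addNr.
by rewrite mul1r cl c1 scaleNr addrC.
Qed.

(* In Sweedler notation this is
   (b1 (/) b4) (x) (b2 (/) b3) = (b1 (/) b2) (x) 1 = counit b 1 (x) 1. *)
Lemma tens_comul_comul b : tens_comul (comul b) = counit b *: ((1 : Q) \ox (1 : Q)).
Proof.
rewrite /tens_comul /oslash_mix.
rewrite (coassoc_sum (F := fun x1 x2 y => tlift (fun y1 y2 =>
   (x1 \oslash y2) \ox (x2 \oslash y1)) (comul y))); [| by lin | by lin | by lin].
transitivity (tlift (fun x z : B => (x \oslash z) \ox (1 : Q)) (comul b)).
  apply: eq_tlift => x z.
  rewrite -(coassoc_sum (F := fun x2 y1 y2 =>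
    (x \oslash y2) \ox (x2 \oslash y1))); [| by lin | by lin | by lin].
  rewrite -(counitl_sum (F := fun y => (x \oslash y) \ox (1 : Q))); last by lin.
  apply: eq_tlift => s y.
  rewrite -(tlift_comp (g := fun q : Q => (x \oslash y) \ox q)); last by lin.
  rewrite -(tlift_comp (g := @oslash_pi k B)); last by lin.
  by rewrite tlift_tens oslash_pi_comul (islinZ _ _ (lin_tensr _ (@lin_id _ _))).
rewrite -(tlift_comp (g := fun q : Q => q \ox (1 : Q))); last by lin.
rewrite -(tlift_comp (g := @oslash_pi k B)); last by lin.
by rewrite tlift_tens oslash_pi_comul (islinZ _ _ (lin_tensl _ (@lin_id _ _))).
Qed.

Fact tens_comul_rel t : oslash_rel (B := B) t -> tens_comul t = 0.
Proof.
by move=> [s [b [b0 ->]]]; rewrite tens_comulM tens_comul_comul b0 scale0r mulr0.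
Qed.

Definition oslash_comul (x : Q) : tensor Q Q := tens_comul (lrepr x).

Lemma oslash_comul_pi s : oslash_comul (oslash_pi s) = tens_comul s.
Proof. exact: (lquot_liftE (islinP tens_comul_lin) tens_comul_rel). Qed.

Fact oslash_comul_linear : linear oslash_comul.
Proof. exact: (lquot_lift_linear (islinP tens_comul_lin) tens_comul_rel). Qed.

Fact oslash_comul_monoid : monoid_morphism oslash_comul.
Proof.
split=> [|x y]; last first.
  have [s ->] := oslash_piP x; have [t ->] := oslash_piP y.
  by rewrite -oslash_piM !oslash_comul_pi tens_comulM.
rewrite -oslash_pi1 oslash_comul_pi tens1 tens_comulE !rmorph1.
by rewrite tens1 oslash_mixE.
Qed.

Fact oslash_counit_linear : scalar (@oslash_counit k B).
Proof. exact: (lquot_lift_linear (islinP (@tens_counit_lin k B)) (@tens_counit_rel k B)). Qed.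

Fact oslash_counit_monoid : monoid_morphism (@oslash_counit k B).
Proof.
split=> [|x y]; last first.
  have [s ->] := oslash_piP x; have [t ->] := oslash_piP y.
  by rewrite -oslash_piM !oslash_counit_pi tens_counitM.
by rewrite -oslash_pi1 oslash_counit_pi tens1 tens_counitE !rmorph1 mulr1.
Qed.

Lemma oslash_ext (X : lmodType k) (f g : Q -> X) :
  islin f -> islin g -> (forall x y, f (x \oslash y) = g (x \oslash y)) -> f =1 g.
Proof.
move=> fl gl fg q; have [s ->] := oslash_piP q.
move: s; apply: tensor_ext; [exact: lin_comp fl oslash_pi_islin
  | exact: lin_comp gl oslash_pi_islin | exact: fg].
Qed.

Lemma oslash_comulE (x y : B) : oslash_comul (x \oslash y) =
  tlift (fun x1 x2 => tlift (fun y1 y2 =>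
    (x1 \oslash y2) \ox (x2 \oslash y1)) (comul y)) (comul x).
Proof. by rewrite /oslash oslash_comul_pi tens_comulE. Qed.

Lemma oslash_counitE (x y : B) :
  oslash_counit (x \oslash y) = counit x * counit y.
Proof. by rewrite /oslash oslash_counit_pi tens_counitE. Qed.

End OslashBialgebra.

Section OslashCoassoc.
Variables (k : fieldType) (B : comBialgType k).
Local Notation Q := (Oslash B).

Lemma lin_oslash_comul (U : lmodType k) (f : U -> Q) :
  islin f -> islin (fun x => oslash_comul (f x)).
Proof. by apply: lin_comp; apply: islinI; apply: oslash_comul_linear. Qed.

Ltac linq_base :=
  lazymatch goal with
  | |- islin (fun x => oslash_comul (@?f x)) => refine (@lin_oslash_comul _ f _)
  end.
Ltac linq := repeat (first [linq_base | lin_step]; cbv beta).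

Lemma lin_tassoc : islin (@tassoc k Q Q Q).
Proof. by rewrite /tassoc; lin. Qed.

Lemma tassocE (u v w : Q) : tassoc ((u \ox v) \ox w) = u \ox (v \ox w).
Proof. by rewrite /tassoc !tliftb; lin. Qed.

Lemma oslash_comulA q :
  tassoc (tmap (@oslash_comul k B) id (oslash_comul q)) =
  tmap id (@oslash_comul k B) (oslash_comul q).
Proof.
pose L := tmap (@oslash_comul k B) (@id Q).
pose R := tmap (@id Q) (@oslash_comul k B).
have Ll : islin L by rewrite /L /tmap; linq.
have Rl : islin R by rewrite /R /tmap; linq.
have al := lin_tassoc.
have LE u v : L (u \ox v) = oslash_comul u \ox v.
  by rewrite /L /tmap tliftb //; linq.
have RE u v : R (u \ox v) = u \ox oslash_comul v.
  by rewrite /R /tmap tliftb //; linq.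
rewrite -/L -/R; move: q; apply: oslash_ext => [||x y].
- by apply: lin_comp al _; apply: lin_comp Ll _; linq.
- by apply: lin_comp Rl _; linq.
rewrite oslash_comulE.
pose F (x1 x2 x3 y1 y2 y3 : B) : tensor Q (tensor Q Q) :=
  (x1 \oslash y3) \ox ((x2 \oslash y2) \ox (x3 \oslash y1)).
have F1 x2 x3 y1 y2 y3 : islin (fun x => F x x2 x3 y1 y2 y3) by rewrite /F; lin.
have F2 x1 x3 y1 y2 y3 : islin (fun x => F x1 x x3 y1 y2 y3) by rewrite /F; lin.
have F3 x1 x2 y1 y2 y3 : islin (fun x => F x1 x2 x y1 y2 y3) by rewrite /F; lin.
have F4 x1 x2 x3 y2 y3 : islin (fun y => F x1 x2 x3 y y2 y3) by rewrite /F; lin.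
have F5 x1 x2 x3 y1 y3 : islin (fun y => F x1 x2 x3 y1 y y3) by rewrite /F; lin.
have F6 x1 x2 x3 y1 y2 : islin (fun y => F x1 x2 x3 y1 y2 y) by rewrite /F; lin.
have FE x1 x2 x3 y1 y2 y3 : F x1 x2 x3 y1 y2 y3 =
  (x1 \oslash y3) \ox ((x2 \oslash y2) \ox (x3 \oslash y1)) by [].
clearbody F.
pose G x1 x2 x3 := tlift (fun y1 t => tlift (fun y2 y3 =>
  F x1 x2 x3 y1 y2 y3) (comul t)) (comul y).
have GE x1 x2 x3 : G x1 x2 x3 = tlift (fun t y3 => tlift (fun y1 y2 =>
    F x1 x2 x3 y1 y2 y3) (comul t)) (comul y).
  apply: esym; apply: (coassoc_sum (F := F x1 x2 x3)) => ? ?;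
  [exact: F4 | exact: F5 | exact: F6].
have G0 x1 x2 x3 : G x1 x2 x3 = tlift (fun y1 t => tlift (fun y2 y3 =>
  F x1 x2 x3 y1 y2 y3) (comul t)) (comul y) by exact: (erefl (G x1 x2 x3)).
have G1 x2 x3 : islin (fun x => G x x2 x3) by rewrite /G; lin; apply: F1.
have G2 x1 x3 : islin (fun x => G x1 x x3) by rewrite /G; lin; apply: F2.
have G3 x1 x2 : islin (fun x => G x1 x2 x) by rewrite /G; lin; apply: F3.
clearbody G.
transitivity (tlift (fun s x3 => tlift (fun x1 x2 => G x1 x2 x3) (comul s))
    (comul x)).
  rewrite (tlift_comp _ _ Ll) (tlift_comp _ _ al); apply: eq_tlift => s x3.
  rewrite (tlift_comp _ _ Ll) (tlift_comp _ _ al).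
  under [RHS]eq_tlift => x1 x2 do rewrite G0.
  rewrite [RHS]exch_tlift.
  apply: eq_tlift => y1 t; rewrite LE oslash_comulE.
  rewrite (tlift_comp (g := fun q : tensor Q Q => q \ox (x3 \oslash y1))); last by lin.
  rewrite (tlift_comp _ _ al); apply: eq_tlift => x1 x2.
  rewrite (tlift_comp (g := fun q : tensor Q Q => q \ox (x3 \oslash y1))); last by lin.
  rewrite (tlift_comp _ _ al); apply: eq_tlift => y2 y3.
  by rewrite tassocE FE.
rewrite (coassoc_sum (F := G)) //.
rewrite (tlift_comp _ _ Rl); apply: eq_tlift => x1 s.
rewrite (tlift_comp _ _ Rl).
transitivity (tlift (fun t y3 => tlift (fun x2 x3 => tlift (fun y1 y2 =>
   F x1 x2 x3 y1 y2 y3) (comul t)) (comul s)) (comul y)).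
  by rewrite -exch_tlift; apply: eq_tlift => x2 x3; apply: GE.
apply: eq_tlift => t y3; rewrite RE oslash_comulE.
rewrite (tlift_comp (g := fun q : tensor Q Q => (x1 \oslash y3) \ox q)); last by lin.
apply: eq_tlift => x2 x3.
rewrite (tlift_comp (g := fun q : tensor Q Q => (x1 \oslash y3) \ox q)); last by lin.
by apply: eq_tlift => y1 y2; rewrite FE.
Qed.

Lemma lin_oslash_counit (U W : lmodType k) (f : U -> Q) (w : W) :
  islin f -> islin (fun x => oslash_counit (f x) *: w).
Proof.
move=> /islinP fl; apply: lin_scalel => a x y.
by rewrite fl oslash_counit_linear.
Qed.

Lemma oslash_counitl q : tlift (fun u v : Q => oslash_counit u *: v) (oslash_comul q) = q.
Proof.
have gl : islin (tlift (fun u v : Q => oslash_counit u *: v)).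
  by lin; apply: lin_oslash_counit; lin.
move: q; apply: oslash_ext => [||x y]; [by apply: lin_comp gl _; linq | by lin |].
rewrite oslash_comulE (tlift_comp _ _ gl).
rewrite -[RHS](counitl_sum (F := fun x => x \oslash y)); last by lin.
apply: eq_tlift => x1 x2; rewrite (tlift_comp _ _ gl).
rewrite -[in RHS](counitr_sum (F := fun y => counit x1 *: (x2 \oslash y))); last by lin.
apply: eq_tlift => y1 y2.
rewrite tliftb ?oslash_counitE ?scalerA 1?mulrC //; try by lin.
by move=> v; apply: lin_oslash_counit; lin.
Qed.

Lemma oslash_counitr q : tlift (fun u v : Q => oslash_counit v *: u) (oslash_comul q) = q.
Proof.
have gl : islin (tlift (fun u v : Q => oslash_counit v *: u)).
  by lin; apply: lin_oslash_counit; lin.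
move: q; apply: oslash_ext => [||x y]; [by apply: lin_comp gl _; linq | by lin |].
rewrite oslash_comulE (tlift_comp _ _ gl).
rewrite -[RHS](counitr_sum (F := fun x => x \oslash y)); last by lin.
apply: eq_tlift => x1 x2; rewrite (tlift_comp _ _ gl).
rewrite -[in RHS](counitl_sum (F := fun y => counit x2 *: (x1 \oslash y))); last by lin.
apply: eq_tlift => y1 y2.
rewrite tliftb ?oslash_counitE ?scalerA 1?mulrC //; try by lin.
by move=> v; apply: lin_oslash_counit; lin.
Qed.

HB.instance Definition _ := Algebra_isBialgebra.Build k Q
  (@oslash_comul_linear k B) (@oslash_comul_monoid k B)
  (@oslash_counit_linear k B) (@oslash_counit_monoid k B)
  oslash_comulA oslash_counitl oslash_counitr.

End OslashCoassoc.

(* Main.v *)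
From HB Require Import structures.
From mathcomp Require Import all_boot all_algebra.
From mathcomp Require Import boolp classical_sets.
Require Import Defs.

(** The quotient Q = B (/) B is itself the Hopf envelope of B, with structure
    map b |-> b (/) 1 and antipode x (/) y |-> y (/) x; since Q is commutative it
    is then also the free commutative Hopf algebra on B, and the remaining
    claims are the uniqueness of universal objects ([oslash_iso]).

    The difficulty is that the antipode is well defined. The relations of Q say
    that b1 (/) b2 = counit b: in the convolution algebra Hom (B, Q), the map
    b |-> 1 (/) b is a right inverse of b |-> b (/) 1. The exchange of factors
    preserves the relations exactly when it is a left inverse as well, i.e. when
    b2 (/) b1 = counit b. This is a finiteness phenomenon: every b is a linear
    combination of entries of a square matrix c over B with
    Delta c_ij = sum_l c_il (x) c_lj and counit c_ij = delta_ij
    ([comatrix_span]), and on such a comatrix convolution is the product of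
    matrices over the commutative ring Q, where one-sided inverses are two-sided
    ([oslash_right_left]). [comatrix_span] comes from a shortest decomposition of
    Delta b as a sum of tensors, with dual functionals supplied by Zorn's lemma
    ([separating_functional], [tens_dual_bases]).

    The same reduction to comatrices ([comatrix_ext]) gives the classical facts
    on the antipode S of a Hopf algebra from uniqueness of matrix inverses: S
    reverses products ([antipodeM]) and coproducts ([comul_antipode]), and
    bialgebra maps preserve it ([bialg_antipode]).

    Given a bialgebra map f from B to an arbitrary Hopf algebra K, the extension
    to Q can only be x (/) y |-> f x * S (f y) ([oslash_extension_unique]). It is
    multiplicative even if K is not commutative, because the entries of the
    matrix f c commute with every f x, hence so do those of its inverse S (f c)
    ([bialg_antipode_comm]); it respects the relations of Q by the antipode
    axiom, and it is a coalgebra map because S reverses coproducts. *)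

Set Implicit Arguments.
Unset Strict Implicit.
Unset Printing Implicit Defensive.

Import GRing.Theory.
Local Open Scope ring_scope.

(** * Separating functionals and shortest tensor decompositions *)

Section LinearMaps.
Variables (k : fieldType) (V W : lmodType k).

Lemma islin0 (f : V -> W) : islin f -> f 0 = 0.
Proof. by move=> fl; rewrite -(scale0r 0) islinZ // scale0r. Qed.

Lemma islin_sum (f : V -> W) (I : Type) (r : seq I) (P : pred I) (F : I -> V) :
  islin f -> f (\sum_(i <- r | P i) F i) = \sum_(i <- r | P i) f (F i).
Proof. by move=> fl; apply: (big_morph f (islinD fl) (islin0 fl)). Qed.

Lemma span_mono (P Q : V -> Prop) u :
  (forall x, P x -> Q x) -> lspan P u -> lspan Q u.
Proof.
move=> PQ; elim=> [|a x y Px _ IH]; first exact: span0.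
exact: span_cons (PQ _ Px) IH.
Qed.

Lemma spanB (P : V -> Prop) u v : lspan P u -> lspan P v -> lspan P (u - v).
Proof. by move=> Pu Pv; rewrite -scaleN1r; apply/spanD/spanZ. Qed.

(** Adjoining one vector enlarges a span only by the multiples of that vector;
    this is what turns maximality into codimension one below. *)
Lemma span_extend (P : V -> Prop) x u :
  lspan (fun y => P y \/ y = x) u -> exists a, lspan P (u - a *: x).
Proof.
elim=> [|a y z [Py|->] _ [b Sz]].
- by exists 0; rewrite scale0r subr0; apply: span0.
- by exists b; rewrite -addrA; apply: span_cons.
by exists (a + b); rewrite scalerDl opprD addrACA subrr add0r.
Qed.

(** Zorn's lemma gives a set A, maximal among those for which P and A together
    do not span v. By maximality, adjoining any further u makes v reachable, so
    every u is congruent modulo the span to a unique multiple of v; the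
    coefficient of that multiple is the functional. *)
Lemma separating_functional (P : V -> Prop) v : ~ lspan P v ->
  exists phi : V -> k^o, [/\ islin phi, forall u, P u -> phi u = 0 & phi v = 1].
Proof.
move=> nPv; pose S (A : set V) := lspan (fun u => P u \/ A u).
have [F FS Ftot | A [nAv Amax]] := @Zorn_bigcup V (fun A => ~ S A v).
  suff bound u : S (\bigcup_(X in F) X)%classic u ->
      lspan P u \/ exists2 X, F X & S X u.
    by case/bound=> // -[X FX SX]; apply: FS SX.
  elim=> [|a x y [Px | [X FX Xx]] _ IH]; first by left; apply: span0.
    case: IH => [Sy | [Y FY SY]]; first by left; apply: span_cons.
    by right; exists Y => //; apply: span_cons SY; left.
  right; case: IH => [Sy | [Y FY SY]].
    exists X => //; apply: span_cons; first by right.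
    by apply: span_mono Sy => z; left.
  have [XY | YX] := Ftot _ _ FX FY.
    by exists Y => //; apply: span_cons SY; right; apply: XY.
  exists X => //; apply: span_cons; first by right.
  by apply: span_mono SY => z [Pz | Yz]; [left | right; apply: YX].
have dec u : exists a : k^o, S A (u - a *: v).
  have [Au | nAu] := pselect (A u).
    by exists 0; rewrite scale0r subr0; apply: span_gen; right.
  have /contrapT Av : ~ ~ S (A `|` [set u])%classic v.
    apply: Amax; split; first by move=> z Az; left.
    by move=> /(_ u) sub; apply: nAu; apply: sub; right.
  have [a Sa] : exists a, S A (v - a *: u).
    apply: span_extend; apply: span_mono Av.
    by move=> z [Pz | [Az | ->]]; [left; left | left; right | right].
  have a0 : a != 0 by apply/eqP => a0; apply: nAv; rewrite a0 scale0r subr0 in Sa.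
  exists a^-1; have -> : u - a^-1 *: v = - a^-1 *: (v - a *: u).
    by rewrite scalerBr scalerA mulNr mulVf // !scaleNr scale1r opprK addrC.
  exact: spanZ.
have decU u (a b : k^o) : S A (u - a *: v) -> S A (u - b *: v) -> a = b.
  move=> Sa Sb; apply/eqP; rewrite -subr_eq0; apply/negPn/negP => ab0.
  apply: nAv; rewrite -[v](scalerK ab0); apply: spanZ.
  have -> : (a - b) *: v = (u - b *: v) - (u - a *: v).
    by rewrite scalerBl opprB [RHS]addrC addrA subrK.
  exact: spanB.
have [phi phiP] := choice dec; exists phi; split.
- apply: islinI => a x y; apply: (decU _ _ _ (phiP _)).
  have -> : a *: x + y - (a *: phi x + phi y) *: v =
            a *: (x - phi x *: v) + (y - phi y *: v).
    by rewrite scalerDl scalerBr scalerA opprD addrACA.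
  by apply: spanD; [apply: spanZ|]; apply: phiP.
- move=> u Pu; apply: (decU _ _ _ (phiP u)).
  by rewrite scale0r subr0; apply: span_gen; left.
by apply: (decU _ _ _ (phiP v)); rewrite scale1r subrr; apply: span0.
Qed.

Lemma span_family n (y : 'I_n -> V) u :
  lspan (fun v => exists i, v = y i) u -> exists a : 'I_n -> k, u = \sum_i a i *: y i.
Proof.
elim=> [|a x v [i ->] _ [b ->]].
  by exists (fun=> 0); rewrite big1 // => i _; rewrite scale0r.
exists (fun j => a * (j == i)%:R + b j).
under [RHS]eq_bigr do rewrite scalerDl.
rewrite big_split /=; congr (_ + _); rewrite (bigD1 i) //= eqxx mulr1 big1 ?addr0 //.
by move=> j /negPf ->; rewrite mulr0 scale0r.
Qed.

End LinearMaps.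

Section TensorRank.
Variables (k : fieldType).

Definition tens_sum (V W : lmodType k) n (x : 'I_n -> V) (y : 'I_n -> W) :=
  \sum_i x i \ox y i.

Definition tens_rank_le (V W : lmodType k) (t : tensor V W) n :=
  exists (x : 'I_n -> V) (y : 'I_n -> W), t = tens_sum x y.

Lemma tens_rank_ex (V W : lmodType k) (t : tensor V W) :
  exists n, tens_rank_le t n.
Proof.
move: t; apply: tensor_ind => [x y | s t [n [x [y ->]]] [m [x' [y' ->]]]].
  by exists 1%N, (fun=> x), (fun=> y); rewrite /tens_sum big_ord1.
exists (n + m)%N, (fun i => match split i with inl j => x j | inr j => x' j end).
exists (fun i => match split i with inl j => y j | inr j => y' j end).
rewrite /tens_sum big_split_ord /=; congr (_ + _); apply: eq_bigr => i _.
  by case: split_ordP => j /eqP; rewrite ?eq_shift // => /eqP ->.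
by case: split_ordP => j /eqP; rewrite ?eq_shift // => /eqP ->.
Qed.

(** In a decomposition of minimal length, no y_j lies in the span of the other
    y_i: otherwise its term could be absorbed into the others, by changing the
    x_i. So each y_j is separated from the others by a functional. *)
Lemma minimal_dual (V W : lmodType k) n (x : 'I_n -> V) (y : 'I_n -> W) :
  (forall m, tens_rank_le (tens_sum x y) m -> (n <= m)%N) ->
  exists phi : 'I_n -> W -> k^o,
    (forall j, islin (phi j)) /\ forall i j, phi j (y i) = (i == j)%:R.
Proof.
case: n x y => [|n] x y xy_min.
  by exists (fun _ _ => 0); split=> -[].
suff /choice [phi phiP] j : exists phi : W -> k^o,
    islin phi /\ forall i, phi (y i) = (i == j)%:R.
  by exists phi; split=> [j|i j]; case: (phiP j).
have [|phi [phil phi0 phi1]] :=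
    @separating_functional _ _ (fun v => exists i, v = y (lift j i)) (y j).
  move=> /span_family [a yj].
  suff /xy_min : tens_rank_le (tens_sum x y) n by rewrite ltnn.
  exists (fun i => x (lift j i) + a i *: x j), (fun i => y (lift j i)).
  rewrite /tens_sum (bigD1_ord j) //= {1}yj.
  have xl : islin (fun w : W => x j \ox w) by lin.
  rewrite (islin_sum _ _ _ xl) -big_split /=; apply: eq_bigr => i _.
  have yl : islin (fun v : V => v \ox y (lift j i)) by lin.
  by rewrite (islinD yl) (islinZ _ _ yl) addrC (islinZ _ _ xl).
exists phi; split=> // i; have [->//|] := eqVneq i j.
by rewrite eq_sym => /unlift_some [l -> _]; apply: phi0; exists l.
Qed.

Definition tswap (V W : lmodType k) : tensor V W -> tensor W V :=
  tlift (fun v w => w \ox v).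

Lemma tswap_sum (V W : lmodType k) n (x : 'I_n -> V) (y : 'I_n -> W) :
  tswap (tens_sum x y) = tens_sum y x.
Proof.
have sl : islin (@tswap V W) by rewrite /tswap; lin.
rewrite /tens_sum (islin_sum _ _ _ sl); apply: eq_bigr => i _.
by rewrite /tswap tliftb; lin.
Qed.

(** Minimality of a decomposition is invariant under exchange of the two
    factors, so a shortest one has dual functionals on both sides. *)
Lemma tens_dual_bases (V W : lmodType k) (t : tensor V W) :
  exists n (x : 'I_n -> V) (y : 'I_n -> W)
      (psi : 'I_n -> V -> k^o) (phi : 'I_n -> W -> k^o),
    [/\ t = tens_sum x y,
        forall j, islin (psi j), forall i j, psi j (x i) = (i == j)%:R,
        forall j, islin (phi j) & forall i j, phi j (y i) = (i == j)%:R].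
Proof.
have ex : exists n, `[< tens_rank_le t n >].
  by have [n tn] := tens_rank_ex t; exists n; apply/asboolP.
have [n /asboolP[x [y txy]] n_min] := ex_minnP ex; exists n, x, y.
have [m|phi [phil phiE]] := minimal_dual (x := x) (y := y).
  by rewrite -txy => tm; apply: n_min; apply/asboolP.
have [m [x' [y' /(congr1 (@tswap _ _))]]|psi [psil psiE]] :=
    minimal_dual (x := y) (y := x).
  rewrite !tswap_sum -txy => tm; apply: n_min; apply/asboolP.
  by exists y', x'.
by exists psi, phi; split.
Qed.

End TensorRank.

(** * Comatrices and the fundamental theorem of coalgebras *)

Lemma tlift_sum (k : fieldType) (V W X : lmodType k) (F : V -> W -> X) t
    (I : finType) (x : I -> V) (y : I -> W) : t = \sum_i x i \ox y i ->
  (forall w, islin (fun v => F v w)) -> (forall v, islin (fun w => F v w)) ->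
  tlift F t = \sum_i F (x i) (y i).
Proof.
move=> -> Fl Fr; have tl : islin (tlift F) by lin; [exact: Fl | exact: Fr].
by rewrite (islin_sum _ _ _ tl); apply: eq_bigr => i _; rewrite tliftb.
Qed.

Section Comatrix.
Variables (k : fieldType) (B : bialgType k).

(** The matrix coefficients of a finite-dimensional comodule. On such a family
    the convolution of two linear maps f and g is the product of the matrices
    of their values f c and g c. *)
Definition comatrix (I : finType) (c : I -> I -> B) : Prop :=
  (forall i j, comul (c i j) = \sum_l c i l \ox c l j) /\
  (forall i j, counit (c i j) = (i == j)%:R).

(** The fundamental theorem of coalgebras, in matrix form. If
    Delta b = sum_i x_i (x) y_i with functionals psi, phi dual to the x_i and
    y_j, put c_ij = (id (x) phi_j) (Delta y_i). Applying phi_j to the last leg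
    of coassociativity shows that the x_j span a right comodule with matrix c,
    and applying psi_l to the first leg shows that c is a comatrix; b is then
    recovered from the counit. *)
Lemma comatrix_span (b : B) :
  exists n (c : 'I_n -> 'I_n -> B) (a : 'I_n -> 'I_n -> k),
    comatrix c /\ b = \sum_i \sum_j a i j *: c i j.
Proof.
have [n [x [y [psi [phi [bE psil psiE phil phiE]]]]]] := tens_dual_bases (comul b).
rewrite /tens_sum in bE.
have sl (V : lmodType k) (f : B -> k^o) (v : V) :
    islin f -> islin (fun x => (f x : k) *: v).
  by move=> fl; apply: lin_scalel; apply: islinP fl.
have delta_sum (V : lmodType k) (F : 'I_n -> V) (d : 'I_n -> k) j :
    (forall i, d i = (i == j)%:R) -> \sum_i d i *: F i = F j.
  move=> dE; rewrite (bigD1 j) //= dE eqxx scale1r big1 ?addr0 // => i /negPf ij.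
  by rewrite dE ij scale0r.
have scale_tens (a : k) (t : tensor B B) :
    tlift (fun u v => a *: (u \ox v)) t = a *: t.
  by rewrite -(tlift_comp (g := fun t : tensor B B => a *: t)) ?tlift_tens //; lin.
pose c i j : B := tlift (fun u v => (phi j v : k) *: u) (comul (y i)).
have xE j : comul (x j) = \sum_i x i \ox c i j.
  (* Coassociativity at b, with phi_j applied to the last leg. *)
  have lF1 (v w : B) : islin (fun u : B => (phi j w : k) *: (u \ox v)) by lin.
  have lF2 (u w : B) : islin (fun v : B => (phi j w : k) *: (u \ox v)) by lin.
  have lF3 (u v : B) : islin (fun w => (phi j w : k) *: (u \ox v)) by apply: sl.
  rewrite -[LHS](delta_sum _ (fun i => comul (x i)) _ _ (phiE^~ j)).
  transitivity (tlift (fun s w => tlift (fun u v => (phi j w : k) *: (u \ox v))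
      (comul s)) (comul b)).
    rewrite (tlift_sum bE); first by apply: eq_bigr => i _; rewrite scale_tens.
      by lin; exact: lF1.
    by lin; exact: lF3.
  rewrite (coassoc_sum b lF1 lF2 lF3).
  rewrite (tlift_sum bE); first last.
  - by lin; exact: lF3.
  - by lin; exact: lF1.
  apply: eq_bigr => i _; rewrite /c.
  rewrite (tlift_comp (g := fun u => x i \ox u)); last by lin.
  by apply: eq_tlift => u v; rewrite (islinZ _ _ (lin_tensr _ (@lin_id _ _))).
have cP : comatrix c.
  split=> [l j|l j].
    (* Coassociativity at x_j, with psi_l applied to the first leg. *)
    have lF1 (v w : B) : islin (fun u => (psi l u : k) *: (v \ox w)) by apply: sl.
    have lF2 (u w : B) : islin (fun v : B => (psi l u : k) *: (v \ox w)) by lin.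
    have lF3 (u v : B) : islin (fun w : B => (psi l u : k) *: (v \ox w)) by lin.
    rewrite -[LHS](delta_sum _ (fun i => comul (c i j)) _ _ (psiE^~ l)).
    transitivity (tlift (fun u s => tlift (fun v w => (psi l u : k) *: (v \ox w))
        (comul s)) (comul (x j))).
      rewrite (tlift_sum (xE j)); first by apply: eq_bigr => i _; rewrite scale_tens.
        by lin; exact: lF1.
      by lin; exact: lF3.
    rewrite -(coassoc_sum (x j) lF1 lF2 lF3).
    rewrite (tlift_sum (xE j)); first last.
    - by lin; exact: lF3.
    - by lin; exact: lF1.
    apply: eq_bigr => i _; rewrite (tlift_sum (xE i)) //.
    exact: (delta_sum _ (fun m => c m i \ox c i j) (fun m => psi l (x m)) l).
  have := counitr_sum (F := psi l) (x j) (psil l).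
  rewrite (tlift_sum (xE j)); [|by lin|by lin].
  rewrite (bigD1 l) //= psiE eqxx big1 ?addr0; last first.
    by move=> i /negPf il; rewrite psiE il scaler0.
  by rewrite psiE [j == l]eq_sym => <-; rewrite -[LHS]mulr1.
exists n, c, (fun m j => counit (x m) * counit (y j)); split=> //.
have := comul_counitr b; rewrite (tlift_sum bE) => [<-||]; try by lin.
rewrite exchange_big; apply: eq_bigr => j _ /=.
have := comul_counitl (x j); rewrite (tlift_sum (xE j)) => [xjE||]; try by lin.
rewrite -[in LHS]xjE scaler_sumr; apply: eq_bigr => m _.
by rewrite scalerA mulrC.
Qed.

(** This replaces computations in Sweedler notation by computations with
    matrices, where inverses are unique and convolution is a matrix product. *)
Lemma comatrix_ext (X : lmodType k) (f g : B -> X) : islin f -> islin g ->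
  (forall n (c : 'I_n -> 'I_n -> B), comatrix c ->
     forall i j, f (c i j) = g (c i j)) ->
  f =1 g.
Proof.
move=> fl gl fg b; have [n [c [a [cP ->]]]] := comatrix_span b.
rewrite (islin_sum _ _ _ fl) (islin_sum _ _ _ gl); apply: eq_bigr => i _.
rewrite (islin_sum _ _ _ fl) (islin_sum _ _ _ gl); apply: eq_bigr => j _.
by rewrite (islinZ _ _ fl) (islinZ _ _ gl) (fg n c cP).
Qed.

Lemma tlift_comatrix (X : lmodType k) (F : B -> B -> X) (I : finType)
    (c : I -> I -> B) i j : comatrix c ->
  (forall y, islin (fun x => F x y)) -> (forall x, islin (fun y => F x y)) ->
  tlift F (comul (c i j)) = \sum_l F (c i l) (c l j).
Proof. by move=> cP Fl Fr; rewrite (tlift_sum (cP.1 i j)). Qed.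

End Comatrix.

(** * Inverse matrices *)

(** Matrices are kept as families indexed by an arbitrary finite type so that
    the entrywise products of two matrices, indexed by pairs, fit the same
    statements. *)
Definition right_inverse_family (R : pzRingType) (I : finType) (a b : I -> I -> R) :=
  forall i j, \sum_l a i l * b l j = (i == j)%:R.

Section InverseFamilies.
Variables (R : pzRingType) (I : finType).
Implicit Types a b c : I -> I -> R.

Lemma sum_delta_l c i j : \sum_l (i == l)%:R * c l j = c i j.
Proof.
rewrite (bigD1 i) //= eqxx mul1r big1 ?addr0 // => l /negPf li.
by rewrite eq_sym li mul0r.
Qed.

Lemma sum_delta_r c i j : \sum_l c i l * (l == j)%:R = c i j.
Proof.
rewrite (bigD1 j) //= eqxx mulr1 big1 ?addr0 // => l /negPf lj.
by rewrite lj mulr0.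
Qed.

Lemma inverse_family_unique a b c :
  right_inverse_family a b -> right_inverse_family b c -> a =2 c.
Proof.
move=> ab bc i j; rewrite -[LHS]sum_delta_r -[RHS]sum_delta_l.
under eq_bigr do rewrite -bc mulr_sumr.
under [RHS]eq_bigr do rewrite -ab mulr_suml.
rewrite exchange_big; apply: eq_bigr => l _; apply: eq_bigr => m _.
by rewrite mulrA.
Qed.

(** An element commuting with an invertible matrix commutes with its inverse:
    z a = a c z a = a z c a = a z. *)
Lemma inverse_family_comm a c z :
  right_inverse_family a c -> right_inverse_family c a ->
  (forall i j, z * c i j = c i j * z) -> forall i j, z * a i j = a i j * z.
Proof.
move=> ac ca zc i j.
transitivity (\sum_l (\sum_m a i m * c m l) * (z * a l j)).
  by under eq_bigr do rewrite ac; rewrite (sum_delta_l (fun l j => z * a l j)).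
transitivity (\sum_m a i m * z * \sum_l c m l * a l j); last first.
  by under eq_bigr do rewrite ca; rewrite (sum_delta_r (fun i m => a i m * z)).
under eq_bigr do rewrite mulr_suml.
rewrite exchange_big; apply: eq_bigr => m _ /=; rewrite mulr_sumr.
by apply: eq_bigr => l _; rewrite -!mulrA [z * (c m l * _)]mulrA zc !mulrA.
Qed.

End InverseFamilies.

(** Over a commutative ring a one-sided inverse of a square matrix is two-sided,
    by the adjugate. *)
Lemma inverse_familyC (R : comPzRingType) n (a b : 'I_n -> 'I_n -> R) :
  right_inverse_family a b -> right_inverse_family b a.
Proof.
move=> ab; pose A := \matrix_(i, j) a i j; pose C := \matrix_(i, j) b i j.
have /mulmx1C AC : A *m C = 1%:M.
  apply/matrixP => i j; rewrite !mxE -ab.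
  by apply: eq_bigr => l _; rewrite !mxE.
move=> i j; have /matrixP/(_ i j) := AC; rewrite !mxE => <-.
by apply: eq_bigr => l _; rewrite !mxE.
Qed.

(** * The antipode of a Hopf algebra *)

Section Antipode.
Variables (k : fieldType) (H : hopfType k).
Local Notation S := (@antipode k H).

Lemma antipode_islin : islin S.
Proof. by apply: islinI; apply: linearP. Qed.

Lemma comatrix_antipode (I : finType) (c : I -> I -> H) : comatrix c ->
  right_inverse_family (fun i j => S (c i j)) c /\
  right_inverse_family c (fun i j => S (c i j)).
Proof.
move=> cP; have Sl := antipode_islin; split=> i j.
  have := antipodel (c i j); rewrite (tlift_comatrix _ _ cP) => [->||]; try by lin.
  by rewrite cP.2 scaler_nat.
have := antipoder (c i j); rewrite (tlift_comatrix _ _ cP) => [->||]; try by lin.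
by rewrite cP.2 scaler_nat.
Qed.

Lemma antipode1 : S 1 = 1.
Proof.
have Sl := antipode_islin.
have := antipodel (1 : H).
by rewrite !rmorph1 tens1 tliftb ?mulr1 ?scale1r //; lin.
Qed.

End Antipode.

Section BialgebraMultiplicativity.
Variables (k : fieldType) (B : bialgType k).

Lemma comulM (x y : B) : comul (x * y) = comul x * comul y.
Proof. exact: (rmorphM (@comul k B)). Qed.

Lemma comul1 : comul (1 : B) = 1.
Proof. exact: (rmorph1 (@comul k B)). Qed.

Lemma counitM (x y : B) : counit (x * y) = counit x * counit y.
Proof. exact: (rmorphM (@counit k B)). Qed.

Lemma counit1 : counit (1 : B) = 1.
Proof. exact: (rmorph1 (@counit k B)). Qed.

Lemma counit_sum (I : finType) (F : I -> B) :
  counit (\sum_i F i) = \sum_i counit (F i).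
Proof. exact: (raddf_sum (@counit k B)). Qed.

End BialgebraMultiplicativity.

(** The Kronecker product of two comatrices, i.e. the tensor product of the
    corresponding comodules. *)
Lemma comatrixM (k : fieldType) (B : bialgType k) (I J : finType)
    (c : I -> I -> B) (d : J -> J -> B) : comatrix c -> comatrix d ->
  comatrix (fun p q : I * J => c p.1 q.1 * d p.2 q.2).
Proof.
move=> cP dP; split=> [[i p] [j q]|[i p] [j q]] /=; last first.
  by rewrite counitM cP.2 dP.2 -natrM mulnb.
rewrite comulM cP.1 dP.1 big_distrlr pair_bigA /=.
by apply: eq_bigr => -[l m] _; rewrite tensM.
Qed.

Section AntipodeAnti.
Variables (k : fieldType) (H : hopfType k).
Local Notation S := (@antipode k H).

(** Both sides invert the Kronecker product of the comatrices of x and y. *)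
Lemma antipodeM x y : S (x * y) = S y * S x.
Proof.
have Sl := @antipode_islin k H.
move: x; apply: comatrix_ext; [| |move=> n c cP i j].
- by apply: lin_comp Sl _; lin.
- by lin.
move: y; apply: comatrix_ext; [| |move=> m d dP p q].
- by apply: lin_comp Sl _; lin.
- by lin.
have [cS Sc] := comatrix_antipode cP; have [dS Sd] := comatrix_antipode dP.
have [cdS _] := comatrix_antipode (comatrixM cP dP).
apply: (inverse_family_unique cdS (c := fun p q => S (d p.2 q.2) * S (c p.1 q.1))
  _ (i, p) (j, q)) => -[i' p'] [j' q'] /=.
rewrite -(pair_bigA _ (fun l m => c i' l * d p' m * (S (d m q') * S (c l j')))) /=.
transitivity (\sum_l c i' l * (p' == q')%:R * S (c l j')).
  apply: eq_bigr => l _; rewrite -Sd mulr_sumr mulr_suml.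
  by apply: eq_bigr => r _; rewrite !mulrA.
rewrite -pair_eqE /=; case: (p' == q'); rewrite ?andbT ?andbF.
  by rewrite -Sc; apply: eq_bigr => l _; rewrite mulr1.
by rewrite big1 // => l _; rewrite mulr0 mul0r.
Qed.

(** Both sides invert the matrix Delta c over the tensor square. *)
Lemma comul_antipode x : comul (S x) = tlift (fun u v => S v \ox S u) (comul x).
Proof.
have Sl := @antipode_islin k H.
have Fl (u : H) : islin (fun v => S v \ox S u) by lin.
have Fr (v : H) : islin (fun u => S v \ox S u) by lin.
move: x; apply: comatrix_ext; [by lin | by lin |move=> n c cP i j].
rewrite (tlift_comatrix _ _ cP) //.
have [cS Sc] := comatrix_antipode cP.
have DS : right_inverse_family (fun i j => comul (S (c i j))) (fun i j => comul (c i j)).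
  move=> i' j'; under eq_bigr do rewrite -comulM.
  by rewrite -rmorph_sum cS rmorph_nat.
apply: (inverse_family_unique DS (c := fun i j => \sum_l S (c l j) \ox S (c i l))).
move=> i' j' /=.
transitivity (\sum_l (c i' l * S (c l j')) \ox (1 : H)); last first.
  have tl : islin (fun u : H => u \ox (1 : H)) by lin.
  transitivity ((\sum_l c i' l * S (c l j')) \ox (1 : H)).
    by rewrite (islin_sum _ _ _ tl).
  by rewrite Sc; case: (i' == j'); rewrite ?(islin0 tl).
transitivity (\sum_m \sum_l \sum_p (c i' l * S (c p j')) \ox (c l m * S (c m p))).
  apply: eq_bigr => m _; rewrite cP.1 big_distrlr /=.
  by apply: eq_bigr => l _; apply: eq_bigr => p _; rewrite tensM.
rewrite exchange_big; apply: eq_bigr => l _ /=; rewrite exchange_big /=.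
rewrite -(sum_delta_l (fun p _ => (c i' l * S (c p j')) \ox (1 : H)) l l).
apply: eq_bigr => p _.
have tl : islin (fun u : H => (c i' l * S (c p j')) \ox u) by lin.
transitivity ((c i' l * S (c p j')) \ox \sum_m c l m * S (c m p)).
  by rewrite (islin_sum _ _ _ tl).
rewrite Sc; case: (l == p); rewrite ?mul1r // (islin0 tl) mul0r //.
Qed.

Lemma counit_antipode x : counit (S x) = counit x.
Proof.
have Sl := @antipode_islin k H.
apply: (comatrix_ext (f := fun x => counit (S x) : k^o) (g := fun x => counit x : k^o)).
- by lin.
- by lin.
move=> n c cP i j.
have [cS _] := comatrix_antipode cP; have := congr1 counit (cS i j).
rewrite counit_sum rmorph_nat cP.2 => <-.
under eq_bigr do rewrite counitM cP.2.
by rewrite (sum_delta_r (fun i j => counit (S (c i j)))).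
Qed.

End AntipodeAnti.

Section BialgebraMaps.
Variables (k : fieldType).

Lemma bialg_islin (B C : bialgType k) (f : {bialgebra B -> C}) : islin f.
Proof. by apply: islinI; apply: linearP. Qed.

Lemma comatrix_map (B C : bialgType k) (f : {bialgebra B -> C}) (I : finType)
  (c : I -> I -> B) : comatrix c -> comatrix (fun i j => f (c i j)).
Proof.
have fl := bialg_islin f.
move=> cP; split=> i j; last by rewrite counit_morph cP.2.
by rewrite comul_morph /tmap (tlift_comatrix _ _ cP) //; lin.
Qed.

(** For a comatrix c, both f (S c) and S (f c) invert the matrix f c. *)
Lemma bialg_antipode (H K : hopfType k) (f : {bialgebra H -> K}) h :
  f (antipode h) = antipode (f h).
Proof.
have fl := bialg_islin f; have Sl := @antipode_islin k H; have Sl' := @antipode_islin k K.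
move: h; apply: comatrix_ext; [by apply: lin_comp fl _; lin | by apply: lin_comp Sl' _; lin|].
move=> n c cP i j; have [cS _] := comatrix_antipode cP.
have [_ Sfc] := comatrix_antipode (comatrix_map f cP).
apply: (inverse_family_unique (a := fun i j => f (antipode (c i j))) _ Sfc).
move=> i' j'; under eq_bigr do rewrite -rmorphM.
by rewrite -rmorph_sum cS rmorph_nat.
Qed.

(** Although the target need not be commutative, the image of f is, and the
    matrix S (f c) is the inverse of f c. *)
Lemma bialg_antipode_comm (B : comBialgType k) (K : hopfType k)
    (f : {bialgebra B -> K}) x y :
  f x * antipode (f y) = antipode (f y) * f x.
Proof.
have fl := bialg_islin f; have Sl := @antipode_islin k K.
have Sfl : islin (fun y => antipode (f y)) by apply: lin_comp Sl _.
move: y; apply: comatrix_ext; [by apply: lin_mulr | by apply: lin_mull|].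
move=> n c cP i j; have [cS Sc] := comatrix_antipode (comatrix_map f cP).
apply: (inverse_family_comm cS Sc) => i' j'.
by rewrite -!rmorphM mulrC.
Qed.

End BialgebraMaps.

(** * The Hopf algebra structure on the quotient *)

Section OslashHopf.
Variables (k : fieldType) (B : comBialgType k).
Local Notation Q := (Oslash B).

Lemma oslash_left_right (I : finType) (c : I -> I -> B) : comatrix c ->
  right_inverse_family (fun i j => c i j \oslash 1 : Q) (fun i j => 1 \oslash c i j).
Proof.
move=> cP i j; have := oslash_pi_comul (c i j).
rewrite cP.1 (islin_sum _ _ _ (@oslash_pi_islin k B)) cP.2 scaler_nat => <-.
by apply: eq_bigr => l _; rewrite oslashM mulr1 mul1r.
Qed.

(** The defining relations of the quotient only say that b1 (/) b2 = counit b.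
    Commutativity of the quotient turns this one-sided inverse of the matrix
    c (/) 1 into a two-sided one; this is what makes the exchange of the two
    factors below well defined. *)
Lemma oslash_right_left n (c : 'I_n -> 'I_n -> B) : comatrix c ->
  right_inverse_family (fun i j => 1 \oslash c i j : Q) (fun i j => c i j \oslash 1).
Proof. by move/oslash_left_right/inverse_familyC. Qed.

Lemma tlift_oslash_swap_comul b :
  tlift (fun x y => y \oslash x : Q) (comul b) = counit b *: 1.
Proof.
move: b; apply: comatrix_ext; [by lin | by lin |move=> n c cP i j].
rewrite (tlift_comatrix _ _ cP) => [||]; try by lin.
rewrite cP.2 scaler_nat -(oslash_right_left cP).
by apply: eq_bigr => l _; rewrite oslashM mulr1 mul1r.
Qed.

Definition oslash_swap (t : tensor B B) : Q := tlift (fun x y => y \oslash x) t.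

Lemma oslash_swap_islin : islin oslash_swap.
Proof. by rewrite /oslash_swap; lin. Qed.

Lemma oslash_swapE x y : oslash_swap (x \ox y) = y \oslash x.
Proof. by rewrite /oslash_swap tliftb; lin. Qed.

Lemma oslash_swapM s t : oslash_swap (s * t) = oslash_swap s * oslash_swap t.
Proof.
have sl := oslash_swap_islin.
move: s; apply: tensor_ext => [||a c].
- by apply: lin_comp sl _; lin.
- by apply: lin_mull.
move: t; apply: tensor_ext => [||a' c'].
- by apply: lin_comp sl _; lin.
- by apply: lin_mulr.
by rewrite tensM !oslash_swapE oslashM.
Qed.

Lemma oslash_swap_rel t : oslash_rel (B := B) t -> oslash_swap t = 0.
Proof.
move=> [s [b [b0 ->]]].
by rewrite oslash_swapM {2}/oslash_swap tlift_oslash_swap_comul b0 scale0r mulr0.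
Qed.

Definition oslash_antipode : Q -> Q := lquot_lift oslash_swap.

Lemma oslash_antipode_linear : linear oslash_antipode.
Proof. exact: (lquot_lift_linear (islinP oslash_swap_islin) oslash_swap_rel). Qed.

Lemma oslash_antipode_pi s : oslash_antipode (oslash_pi s) = oslash_swap s.
Proof. exact: (lquot_liftE (islinP oslash_swap_islin) oslash_swap_rel). Qed.

Lemma oslash_antipodeE x y : oslash_antipode (x \oslash y) = y \oslash x.
Proof. by rewrite /oslash oslash_antipode_pi oslash_swapE. Qed.

Lemma oslash_comul_comatrix (I J : finType) (c : I -> I -> B) (d : J -> J -> B) i j p q :
  comatrix c -> comatrix d ->
  comul (c i j \oslash d p q : Q) =
  \sum_l \sum_m (c i l \oslash d m q) \ox (c l j \oslash d p m).
Proof.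
move=> cP dP; rewrite [LHS]oslash_comulE (tlift_comatrix _ _ cP); try by lin.
by apply: eq_bigr => l _; rewrite (tlift_comatrix _ _ dP); try by lin.
Qed.

Lemma oslash_comatrix_ext (X : lmodType k) (f g : Q -> X) : islin f -> islin g ->
  (forall n (c : 'I_n -> 'I_n -> B) m (d : 'I_m -> 'I_m -> B),
     comatrix c -> comatrix d ->
     forall i j p q, f (c i j \oslash d p q) = g (c i j \oslash d p q)) ->
  f =1 g.
Proof.
move=> fl gl fg; apply: oslash_ext => // x y.
move: x; apply: comatrix_ext; [by apply: lin_comp fl _; lin | by apply: lin_comp gl _; lin|].
move=> n c cP i j.
move: y; apply: comatrix_ext; [by apply: lin_comp fl _; lin | by apply: lin_comp gl _; lin|].
by move=> m d dP p q; apply: fg.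
Qed.

(** On c_ij (/) d_pq the convolution splits into the product of the (i, j) entry
    of the matrix product of 1 (/) c and c (/) 1, and the (p, q) entry of that
    of 1 (/) d and d (/) 1. *)
Fact oslash_antipodel (x : Q) :
  tlift (fun u v => oslash_antipode u * v) (comul x) = (counit x)%:A.
Proof.
have Al : islin oslash_antipode by apply: islinI; apply: oslash_antipode_linear.
have Fl (v : Q) : islin (fun u : Q => oslash_antipode u * v) by lin.
have Fr (u : Q) : islin (fun v : Q => oslash_antipode u * v) by lin.
have tl : islin (tlift (fun u v : Q => oslash_antipode u * v)) by lin.
move: x; apply: oslash_comatrix_ext; [by apply: lin_comp tl _; lin | by lin|].
move=> n c m d cP dP i j p q.
rewrite (oslash_comul_comatrix _ _ _ _ cP dP) (islin_sum _ _ _ tl).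
transitivity (\sum_l \sum_r ((1 : B) \oslash c i l * (c l j \oslash 1)) *
    ((1 : B) \oslash d p r * (d r q \oslash 1)) : Q).
  apply: eq_bigr => l _; rewrite (islin_sum _ _ _ tl); apply: eq_bigr => r _.
  by rewrite (tliftb _ _ Fl Fr) oslash_antipodeE !oslashM !mul1r !mulr1 [d r q * _]mulrC.
rewrite -big_distrlr /= (oslash_right_left cP) (oslash_right_left dP).
by rewrite [counit _]oslash_counitE cP.2 dP.2 -scalerA !scaler_nat mulr_natr -mulrnA mulnC mulrnA.
Qed.

Fact oslash_antipoder (x : Q) :
  tlift (fun u v => u * oslash_antipode v) (comul x) = (counit x)%:A.
Proof.
have Al : islin oslash_antipode by apply: islinI; apply: oslash_antipode_linear.
have Fl (v : Q) : islin (fun u : Q => u * oslash_antipode v) by lin.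
have Fr (u : Q) : islin (fun v : Q => u * oslash_antipode v) by lin.
have tl : islin (tlift (fun u v : Q => u * oslash_antipode v)) by lin.
move: x; apply: oslash_comatrix_ext; [by apply: lin_comp tl _; lin | by lin|].
move=> n c m d cP dP i j p q.
rewrite (oslash_comul_comatrix _ _ _ _ cP dP) (islin_sum _ _ _ tl).
transitivity (\sum_l \sum_r ((c i l \oslash (1 : B)) * (1 \oslash c l j)) *
    ((d p r \oslash (1 : B)) * (1 \oslash d r q)) : Q).
  apply: eq_bigr => l _; rewrite (islin_sum _ _ _ tl); apply: eq_bigr => r _.
  by rewrite (tliftb _ _ Fl Fr) oslash_antipodeE !oslashM !mul1r !mulr1 [d r q * _]mulrC.
rewrite -big_distrlr /= (oslash_left_right cP) (oslash_left_right dP).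
by rewrite [counit _]oslash_counitE cP.2 dP.2 -scalerA !scaler_nat mulr_natr -mulrnA mulnC mulrnA.
Qed.

HB.instance Definition _ := Bialgebra_isHopf.Build k Q
  oslash_antipode_linear oslash_antipodel oslash_antipoder.

End OslashHopf.

(** * Composition of bialgebra maps *)

Section BialgebraMapConstructions.
Variables (k : fieldType).

Lemma tmap_comp (U V W U' V' W' : lmodType k) (f : U -> V) (f' : U' -> V')
    (g : V -> W) (g' : V' -> W') t :
  islin f -> islin f' -> islin g -> islin g' ->
  tmap g g' (tmap f f' t) = tmap (fun x => g (f x)) (fun x => g' (f' x)) t.
Proof.
move=> fl fl' gl gl'; have gg : islin (tmap g g') by rewrite /tmap; lin.
rewrite {2}/tmap (tlift_comp _ _ gg); apply: eq_tlift => x y.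
by rewrite /tmap tliftb //; lin.
Qed.

Fact id_comul (B : bialgType k) (b : B) : comul (idfun b) = tmap idfun idfun (comul b).
Proof. by rewrite /tmap tlift_tens. Qed.

Fact id_counit (B : bialgType k) (b : B) : counit (idfun b) = counit b.
Proof. by []. Qed.

HB.instance Definition _ (B : bialgType k) :=
  isCoalgMorphism.Build k B B idfun (@id_comul B) (@id_counit B).

Section Comp.
Variables (A B C : bialgType k) (g : {bialgebra B -> C}) (f : {bialgebra A -> B}).

Fact comp_comul a : comul ((g \o f) a) = tmap (g \o f) (g \o f) (comul a).
Proof. by rewrite /= !comul_morph tmap_comp //; apply: bialg_islin. Qed.

Fact comp_counit a : counit ((g \o f) a) = counit a.
Proof. by rewrite /= !counit_morph. Qed.

HB.instance Definition _ := isCoalgMorphism.Build k A C (g \o f) comp_comul comp_counit.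

End Comp.

Definition bialg_comp (A B C : bialgType k) (g : {bialgebra B -> C})
  (f : {bialgebra A -> B}) : {bialgebra A -> C} := g \o f.

Definition bialg_id (B : bialgType k) : {bialgebra B -> B} := idfun.

Definition hopf_of_bialg (H K : hopfType k) (f : {bialgebra H -> K}) : {hopf H -> K} :=
  HB.pack (BialgMorphism.sort f) (isAntipodeMorphism.Build k H K f (bialg_antipode f)).

End BialgebraMapConstructions.

(** * Extending bialgebra maps to the quotient *)

Section Unit.
Variables (k : fieldType) (B : comBialgType k).
Local Notation Q := (Oslash B).

Definition oslash_left (b : B) : Q := b \oslash 1.

Fact oslash_left_linear : linear oslash_left.
Proof. by apply: islinP; rewrite /oslash_left; lin. Qed.

Fact oslash_left_monoid : monoid_morphism oslash_left.
Proof. by split=> [|x y] //; rewrite /oslash_left oslashM mulr1. Qed.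

Fact oslash_left_comul b :
  comul (oslash_left b) = tmap oslash_left oslash_left (comul b).
Proof.
rewrite [LHS]oslash_comulE; apply: eq_tlift => x y.
by rewrite comul1 tens1 tliftb //; lin.
Qed.

Fact oslash_left_counit b : counit (oslash_left b) = counit b.
Proof. by rewrite [LHS]oslash_counitE counit1 mulr1. Qed.

HB.instance Definition _ :=
  GRing.isLinear.Build k B Q *:%R oslash_left oslash_left_linear.
HB.instance Definition _ :=
  GRing.isMonoidMorphism.Build B Q oslash_left oslash_left_monoid.
HB.instance Definition _ :=
  isCoalgMorphism.Build k B Q oslash_left oslash_left_comul oslash_left_counit.

Definition oslash_unit : {bialgebra B -> Q} := oslash_left.

Lemma antipode_oslash (x y : B) : antipode (x \oslash y : Q) = y \oslash x.
Proof. exact: oslash_antipodeE. Qed.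

Lemma oslash_factor (x y : B) :
  x \oslash y = oslash_unit x * antipode (oslash_unit y) :> Q.
Proof. by rewrite antipode_oslash oslashM mulr1 mul1r. Qed.

End Unit.

Section Universal.
Variables (k : fieldType) (B : comBialgType k) (K : hopfType k) (f : {bialgebra B -> K}).
Local Notation Q := (Oslash B).
Local Notation S := antipode.

Definition tens_extend : tensor B B -> K := tlift (fun x y => f x * S (f y)).

Let fl := bialg_islin f.
Let Sl := @antipode_islin k K.
Let Sfl : islin (fun y => S (f y)).
Proof. exact: lin_comp Sl fl. Qed.
Let Fl (y : B) : islin (fun x => f x * S (f y)).
Proof. exact: lin_mull fl. Qed.
Let Fr (x : B) : islin (fun y => f x * S (f y)).
Proof. exact: lin_mulr Sfl. Qed.

Lemma tens_extend_islin : islin tens_extend.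
Proof. by rewrite /tens_extend; lin. Qed.

Lemma tens_extendE x y : tens_extend (x \ox y) = f x * S (f y).
Proof. by rewrite /tens_extend tliftb. Qed.

(** Since B is commutative, S (f (c c')) = S (f (c' c)) = S (f c) S (f c'), and
    S (f c) moves past f a' because the two commute. *)
Lemma tens_extendM s t : tens_extend (s * t) = tens_extend s * tens_extend t.
Proof.
have gl := tens_extend_islin.
move: s; apply: tensor_ext => [||a c].
- by apply: lin_comp gl _; lin.
- by apply: lin_mull.
move: t; apply: tensor_ext => [||a' c'].
- by apply: lin_comp gl _; lin.
- by apply: lin_mulr.
rewrite tensM !tens_extendE [c * c']mulrC !rmorphM antipodeM !mulrA.
by rewrite -[f a * f a' * _]mulrA (bialg_antipode_comm f a' c) !mulrA.
Qed.

Lemma tens_extend_comul b : tens_extend (comul b) = counit b *: 1.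
Proof.
have ml : islin (tlift (fun x y : K => x * S y)) by lin.
have -> : counit b = counit (f b) by rewrite counit_morph.
rewrite -antipoder comul_morph /tmap (tlift_comp _ _ ml).
by apply: eq_tlift => x y; rewrite tliftb //; lin.
Qed.

Lemma tens_extend_rel t : oslash_rel (B := B) t -> tens_extend t = 0.
Proof.
by move=> [s [b [b0 ->]]]; rewrite tens_extendM tens_extend_comul b0 scale0r mulr0.
Qed.

Definition oslash_extend : Q -> K := lquot_lift tens_extend.

Lemma oslash_extend_pi s : oslash_extend (oslash_pi s) = tens_extend s.
Proof. exact: (lquot_liftE (islinP tens_extend_islin) tens_extend_rel). Qed.

Lemma oslash_extendE x y : oslash_extend (x \oslash y) = f x * S (f y).
Proof. by rewrite /oslash oslash_extend_pi tens_extendE. Qed.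

Fact oslash_extend_linear : linear oslash_extend.
Proof. exact: (lquot_lift_linear (islinP tens_extend_islin) tens_extend_rel). Qed.

Let gl : islin oslash_extend := islinI oslash_extend_linear.

Fact oslash_extend_monoid : monoid_morphism oslash_extend.
Proof.
split=> [|x y].
  by rewrite -oslash_pi1 tens1 oslash_extendE rmorph1 antipode1 mulr1.
move: x; apply: oslash_ext => [||a c].
- by apply: lin_comp gl _; lin.
- by apply: lin_mull.
move: y; apply: oslash_ext => [||a' c'].
- by apply: lin_comp gl _; lin.
- by apply: lin_mulr.
by rewrite oslashM !oslash_extendE -!tens_extendE -tens_extendM tensM.
Qed.

Fact oslash_extend_comul q :
  comul (oslash_extend q) = tmap oslash_extend oslash_extend (comul q).
Proof.
have ggl : islin (tmap oslash_extend oslash_extend) by rewrite /tmap; lin.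
move: q; apply: oslash_comatrix_ext; [by lin | by apply: lin_comp ggl _; lin |].
move=> n c m d cP dP i j p q.
rewrite oslash_extendE comulM comul_antipode.
rewrite (tlift_comatrix _ _ (comatrix_map f dP)); try by lin.
rewrite (comatrix_map f cP).1 big_distrlr /=.
rewrite (oslash_comul_comatrix _ _ _ _ cP dP) (islin_sum _ _ _ ggl).
apply: eq_bigr => l _; rewrite (islin_sum _ _ _ ggl).
apply: eq_bigr => r _; rewrite tensM.
by rewrite /tmap tliftb ?oslash_extendE //; lin.
Qed.

Fact oslash_extend_counit q : counit (oslash_extend q) = counit q.
Proof.
apply: (oslash_ext (f := fun q => counit (oslash_extend q) : k^o)
  (g := fun q => counit q : k^o) _ _ _ q); [by lin | by lin | move=> x y].
by rewrite oslash_extendE counitM counit_antipode !counit_morph [RHS]oslash_counitE.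
Qed.

HB.instance Definition _ :=
  GRing.isLinear.Build k Q K *:%R oslash_extend oslash_extend_linear.
HB.instance Definition _ :=
  GRing.isMonoidMorphism.Build Q K oslash_extend oslash_extend_monoid.
HB.instance Definition _ :=
  isCoalgMorphism.Build k Q K oslash_extend oslash_extend_comul oslash_extend_counit.

Lemma oslash_extend_unit b : oslash_extend (oslash_unit B b) = f b.
Proof. by rewrite oslash_extendE rmorph1 antipode1 mulr1. Qed.

Definition oslash_hopf_extend : {hopf Q -> K} :=
  hopf_of_bialg (oslash_extend : {bialgebra Q -> K}).

End Universal.

(** * Comparison of universal objects *)

Section Envelope.
Variables (k : fieldType) (B : comBialgType k).
Local Notation Q := (Oslash B).
Local Notation i := (oslash_unit B).

(** The quotient is generated by the image of B and its antipode. *)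
Lemma oslash_extension_unique (K : hopfType k) (f : {bialgebra B -> K}) (g : {hopf Q -> K}) :
  g \o i =1 f -> g =1 oslash_hopf_extend f.
Proof.
move=> gf; have gl := bialg_islin g.
apply: oslash_ext => // [|x y]; first exact: bialg_islin.
have gM u v : g (u * v) = g u * g v by exact: rmorphM.
have gS u : g (antipode u) = antipode (g u) by exact: antipode_morph.
have gi b : g (i b) = f b by exact: gf.
by rewrite [RHS]oslash_extendE oslash_factor gM gS !gi.
Qed.

Lemma oslash_unit_envelope : is_hopf_envelope i.
Proof.
move=> K f; exists (oslash_hopf_extend f); split=> [b | g].
  exact: oslash_extend_unit.
exact: oslash_extension_unique.
Qed.

Lemma universal_endo_id (A : bialgType k) (H : hopfType k) (eta : {bialgebra A -> H})
    (u : {hopf H -> H}) :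
  (exists g : {hopf H -> H}, g \o eta =1 eta /\
     forall g' : {hopf H -> H}, g' \o eta =1 eta -> g' =1 g) ->
  u \o eta =1 eta -> u =1 id.
Proof.
move=> [g [_ g_unique]] u_eta x.
by rewrite (g_unique u u_eta) -(g_unique (hopf_of_bialg (bialg_id H))).
Qed.

(** The usual comparison of two universal objects. Besides the map h, only
    the universality of eta towards H itself is needed; both are available for
    the Hopf envelope and for the free commutative Hopf algebra alike, Q and H
    being commutative in the second case. *)
Lemma oslash_iso (H : hopfType k) (eta : {bialgebra B -> H}) (h : {hopf H -> Q}) :
  (exists g : {hopf H -> H}, g \o eta =1 eta /\
     forall g' : {hopf H -> H}, g' \o eta =1 eta -> g' =1 g) ->
  h \o eta =1 i ->
  cancel (oslash_extend eta) h /\ cancel h (oslash_extend eta).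
Proof.
move=> eta_self h_eta.
have hE b : h (eta b) = i b by exact: h_eta.
pose e := oslash_hopf_extend eta; split.
  pose u := hopf_of_bialg (bialg_comp h e).
  apply: (universal_endo_id (u := u) (oslash_unit_envelope i)) => b.
  by rewrite -hE /= [oslash_extend _ _]oslash_extend_unit.
pose u := hopf_of_bialg (bialg_comp e h).
apply: (universal_endo_id (u := u) eta_self) => b /=.
by rewrite hE; apply: oslash_extend_unit.
Qed.

End Envelope.

Theorem theorem3p16 (k : fieldType) (B : comBialgType k) :
  (exists (H : hopfType k) (eta : {bialgebra B -> H}), is_hopf_envelope eta) /\
  (forall (H : hopfType k) (eta : {bialgebra B -> H}),
     is_free_comm_hopf eta <-> is_hopf_envelope eta) /\
  (forall (H : hopfType k) (eta : {bialgebra B -> H}),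
     is_hopf_envelope eta ->
     exists f : {bialgebra Oslash B -> H},
       bijective f /\
       forall a b : B, f (a \oslash b) = eta a * antipode (eta b)).
Proof.
have QC : commutative (@GRing.mul (Oslash B)) by exact: mulrC.
split; first by exists (Oslash B : hopfType k), (oslash_unit B); apply: oslash_unit_envelope.
split=> H eta; last first.
  move=> env; have [h [h_eta _]] := env _ (oslash_unit B).
  have [fh hf] := oslash_iso (env _ eta) h_eta.
  exists (oslash_extend eta : {bialgebra _ -> _}).
  by split; [exists h | exact: oslash_extendE].
split=> [[HC free] | env].
  have [h [h_eta _]] := free _ (oslash_unit B) QC.
  have [_ hf] := oslash_iso (free _ eta HC) h_eta.
  have hE b : h (eta b) = oslash_unit B b by exact: h_eta.
  move=> K f; exists (hopf_of_bialg (bialg_comp (oslash_hopf_extend f) h)).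
  split=> [b | g g_eta x] /=.
    by rewrite hE; apply: oslash_extend_unit.
  pose v := hopf_of_bialg (bialg_comp g (oslash_hopf_extend eta)).
  have <- : v (h x) = oslash_extend f (h x); last by rewrite /= hf.
  apply: (oslash_extension_unique (g := v)) => b /=.
  by rewrite [oslash_extend _ _]oslash_extend_unit; apply: g_eta.
split=> [x y | K f _]; last exact: env.
have [h [h_eta _]] := env _ (oslash_unit B).
have [_ hf] := oslash_iso (env _ eta) h_eta.
rewrite -[x]hf -[y]hf -[LHS](rmorphM (oslash_extend eta)).
by rewrite -[RHS](rmorphM (oslash_extend eta)) QC.
Qed.
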